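(* Let $A$ be a bounded normal operator in $\mathcal H$ with spectral measure $E$ and let $x\in E(\overline{\mathbb D})\mathcal H$. Then the following statements are equivalent. (i) The sequence $(A^kx)_{k\in\mathbb N}$ is a Bessel sequence in $\mathcal H$. (ii) There exists $C_1>0$ such that for all $r>0$ and all $z\in\mathbb T$ we have $\mu_x(\overline{\mathbb D}\cap B_r(z))\le C_1r$. (iii) $\|(A_{\overline{\mathbb D}}-\lambda)^{-1}x\|^2=O\big((|\lambda|^2-1)^{-1}\big)$ as $|\lambda|\downarrow 1$; that is, there exist $M>0$ and $\eta>0$ such that $\|(A_{\overline{\mathbb D}}-\lambda)^{-1}x\|^2\le M(|\lambda|^2-1)^{-1}$ for all $\lambda\in\mathbb C$ with $1<|\lambda|<1+\eta$.
   Context: $\mathcal H$ is a complex Hilbert space with scalar product $\langle\cdot,\cdot\rangle$. $\mathbb N$ includes zero. $\mathbb D$ is the open unit disc in $\mathbb C$, $\overline{\mathbb D}$ its closure, $\mathbb T$ the unit circle. $B_r(z)$ is the disc of radius $r>0$ and center $z\in\mathbb C$. A sequence $(y_k)_{k\in\mathbb N}$ in $\mathcal H$ is a Bessel sequence if there is $C>0$ such that $\sum_{k\in\mathbb N}|\langle y,y_k\rangle|^2\le C\|y\|^2$ for all $y\in\mathcal H$. The spectral measure $E$ of $A$ is defined on the Borel sets of $\mathbb C$, and $\mu_x(\Delta)=\langle E(\Delta)x,x\rangle=\|E(\Delta)x\|^2$. $A_{\overline{\mathbb D}}$ denotes the restriction of $A$ to its spectral subspace $E(\overline{\mathbb D})\mathcal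 H$ (so its spectrum is contained in $\overline{\mathbb D}$). *)

(* Defs.v *)
From HB Require Import structures.
From mathcomp Require Import all_boot all_order all_algebra complex.
From mathcomp Require Import sesquilinear.
From mathcomp Require Import all_classical all_reals all_analysis.
Import Order.TTheory GRing.Theory Num.Theory Num.Def numFieldNormedType.Exports.

Set Implicit Arguments.
Unset Strict Implicit.
Unset Printing Implicit Defensive.

Local Open Scope classical_set_scope.
Local Open Scope ring_scope.
Local Open Scope complex_scope.

(* Norms over R[i] take values in R[i]; this is the same norm with values in R.
   It applies both to vectors and to complex numbers. *)
Definition rnorm (R : realType) (V : normedZmodType R[i]) (v : V) : R :=
  complex.Re `|v|.

(* MathComp-Analysis puts the topology of R[i] on R[i]^o. *)
Notation borelC R := (g_sigma_algebraType (@open R[i]^o)).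

Definition closed_unit_disc (R : realType) : set (borelC R) :=
  [set z : R[i] | rnorm z <= 1].
Arguments closed_unit_disc {R}.

(* [H] is a Hilbert space for the scalar product [ip] when, moreover, [H] is a
   complete normed module; [ip] is linear in its first argument. *)
Definition norm_from_dot (R : realType) (H : normedModType R[i])
    (ip : {dot H for conjC}) : Prop :=
  forall u : H, `|u| ^+ 2 = ip u u.

Section Operators.
Context {R : realType} {H : completeNormedModType R[i]}.
Variable ip : {dot H for conjC}.
Implicit Types A B : {linear H -> H}.

Definition bounded_operator A : Prop :=
  exists M : R, forall u : H, rnorm (A u) <= M * rnorm u.

Definition is_adjoint A B : Prop := forall u v : H, ip (A u) v = ip u (B v).

Definition normal_operator A : Prop :=
  exists B, is_adjoint A B /\ forall u : H, A (B u) = B (A u).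

Definition is_orthoproj A : Prop :=
  (forall u : H, A (A u) = A u) /\ is_adjoint A A.

Definition spectral_meas (E : set (borelC R) -> {linear H -> H}) (u : H)
    (D : set (borelC R)) : R :=
  complex.Re (ip (E D u) u).

(* Only the values of [E] on Borel sets are constrained. *)
Record projection_valued_measure
    (E : set (borelC R) -> {linear H -> H}) : Prop := {
  pvm_proj : forall D, measurable D -> is_orthoproj (E D) ;
  pvmT : forall u : H, E setT u = u ;
  pvmI : forall D1 D2, measurable D1 -> measurable D2 ->
    forall u : H, E (D1 `&` D2) u = E D1 (E D2 u) ;
  pvm_sigma_additive : forall F : nat -> set (borelC R),
    (forall n, measurable (F n)) -> trivIset setT F ->
    forall u : H, series (fun n => E (F n) u) @ \oo --> E (\bigcup_n F n) u
}.

(* [A] is the integral of z against dE(z), with E carried by a bounded set;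
   the operator integral is expressed by its quadratic form
   <A u, u> = \int z d<E(z) u, u>. *)
Record spectral_measure_of A
    (E : set (borelC R) -> {linear H -> H}) : Prop := {
  spm_pvm : projection_valued_measure E ;
  spm_bounded : exists r : R,
    forall u : H, E [set z : R[i] | rnorm z <= r] u = u ;
  spm_integral : forall u : H,
    let mu D := (spectral_meas E u D)%:E in
    (complex.Re (ip (A u) u))%:E =
      (\int[mu]_(z in [set: borelC R]) (complex.Re (z : R[i]))%:E)%E /\
    (complex.Im (ip (A u) u))%:E =
      (\int[mu]_(z in [set: borelC R]) (complex.Im (z : R[i]))%:E)%E
}.

Definition bessel (y : nat -> H) : Prop :=
  exists C : R, 0 < C /\ forall v : H,
    (\sum_(0 <= k <oo) (rnorm (ip v (y k)) ^+ 2)%:E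
       <= (C * rnorm v ^+ 2)%:E)%E.

(* The value at x of the inverse of the restriction of A - l to the invariant
   subspace V (0 if x is not in its image). *)
Definition restr_resolvent A (V : set H) (l : R[i]) (x : H) : H :=
  'pinv_(fun=> 0) V (fun u => A u - l *: u) x.

Lemma restr_resolventP A (V : set H) (l : R[i]) (x : H) :
  set_bij V V (fun u => A u - l *: u) -> V x ->
  V (restr_resolvent A V l x) /\
  A (restr_resolvent A V l x) - l *: restr_resolvent A V l x = x.
Proof.
move=> [fV finj fsurj] Vx; split; last first.
  by have /(_ x) := surjpK (fun=> 0) fsurj; rewrite inE; apply.
by apply: (surjpinv_image_sub (dflt := fun=> 0) fsurj); exists x.
Qed.

End Operators.

(* Main.v *)
(* A normal operator acts on a vector like multiplication by z on L^2(mu_x), so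
   the Bessel property says that mu_x is a Carleson measure for H^2 of the disc.

   (i) => (iii): if y is the resolvent of x, then iterating A y = l y + x gives
   y = l^-n A^n y - \sum_(k < n) l^-(k+1) A^k x; pair with y, apply
   Cauchy-Schwarz and let n tend to infinity.
   (iii) => (ii): for l = (1 + r) z, the operator A - l has norm O(r) on the
   range of E (D `&` B_r(z)), so |E (D `&` B_r(z)) x| <= O(r) |y|.
   (ii) => (i): a fine Borel partition of the closed disc replaces mu_x by
   finitely many atoms m_j at points w_j of the open disc. For real weights a,
   \sum_k |\sum_j a_j w_j^k|^2 is the quadratic form of the real part of the
   Szego kernel, which is dominated by 1 + N + N^T for the matrix
   N_ij = (1 - |w_i|^2) / |1 - conj w_i w_j|^2. Condition (ii) bounds the rows
   of N, and since |1 - conj z w| is a quasi-metric, L = (m_i m_j)^(1/2) N_ij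
   satisfies L L^T <= c (L + L^T) entrywise, which forces |L^T| <= 2 c. *)

Require Import Defs.
From HB Require Import structures.
From mathcomp Require Import all_boot all_order all_algebra complex.
From mathcomp Require Import sesquilinear.
From mathcomp Require Import all_classical all_reals all_analysis.
From mathcomp Require Import measurable_realfun.
From mathcomp Require Import ring lra.
Import Order.TTheory GRing.Theory Num.Theory Num.Def numFieldNormedType.Exports.

Set Implicit Arguments.
Unset Strict Implicit.
Unset Printing Implicit Defensive.

Local Open Scope classical_set_scope.
Local Open Scope ring_scope.
Local Open Scope complex_scope.

(** * Real-valued norms and scalar products *)

Section RealNorm.
Context {R : realType}.

Section Zmod.
Context {V : normedZmodType R[i]}.
Implicit Types u v : V.

Lemma rnormE u : `|u| = (rnorm u)%:C.
Proof.
rewrite /rnorm -[LHS]RRe_real //; exact: normr_real.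
Qed.

Lemma rnorm_ge0 u : 0 <= rnorm u.
Proof. by rewrite -ler0c -rnormE. Qed.

Lemma rnorm0 : rnorm (0 : V) = 0.
Proof. by rewrite /rnorm normr0. Qed.

Lemma rnormN u : rnorm (- u) = rnorm u.
Proof. by rewrite /rnorm normrN. Qed.

Lemma rnorm_distC u v : rnorm (u - v) = rnorm (v - u).
Proof. by rewrite /rnorm distrC. Qed.

Lemma rnormD u v : rnorm (u + v) <= rnorm u + rnorm v.
Proof. by rewrite -lecR rmorphD /= -!rnormE ler_normD. Qed.

Lemma rnormB u v : rnorm (u - v) <= rnorm u + rnorm v.
Proof. by rewrite (le_trans (rnormD _ _))// rnormN. Qed.

Lemma rnorm_sum I (r : seq I) (P : pred I) (F : I -> V) :
  rnorm (\sum_(i <- r | P i) F i) <= \sum_(i <- r | P i) rnorm (F i).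
Proof.
elim/big_ind2 : _ => //=; first by rewrite rnorm0.
by move=> a x b y xa yb; rewrite (le_trans (rnormD _ _))// lerD.
Qed.

Lemma rnorm_eq0 u : (rnorm u == 0) = (u == 0).
Proof. by rewrite -(inj_eq (@complexI R)) -rnormE normr_eq0. Qed.

End Zmod.

Section Lmod.
Context {V : completeNormedModType R[i]}.

Lemma rnormZ (a : R[i]) (u : V) : rnorm (a *: u) = rnorm a * rnorm u.
Proof.
by apply: complexI; rewrite rmorphM /= -!rnormE normrZ.
Qed.

End Lmod.

Implicit Types z w : R[i].

Lemma rnormM z w : rnorm (z * w) = rnorm z * rnorm w.
Proof. by apply: complexI; rewrite rmorphM /= -!rnormE normrM. Qed.

Lemma rnorm1 : rnorm (1 : R[i]) = 1.
Proof. by rewrite /rnorm normr1. Qed.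

Lemma rnormX z n : rnorm (z ^+ n) = rnorm z ^+ n.
Proof. by elim: n => [|n IH]; rewrite ?expr0 ?rnorm1// !exprS rnormM IH. Qed.

Lemma rnormV z : rnorm z^-1 = (rnorm z)^-1.
Proof. by apply: complexI; rewrite fmorphV /= -!rnormE normfV. Qed.

Lemma rnormJ z : rnorm (conjc z) = rnorm z.
Proof. by rewrite /rnorm normcJ. Qed.

Lemma sqr_rnorm z : rnorm z ^+ 2 = complex.Re z ^+ 2 + complex.Im z ^+ 2.
Proof. by apply: complexI; rewrite rmorphXn /= -rnormE add_Re2_Im2. Qed.

Lemma rnorm_real (r : R) : rnorm r%:C = `|r|.
Proof. by apply/eqP; rewrite -(@eqrXn2 _ 2) ?rnorm_ge0// sqr_rnorm /= expr0n addr0 real_normK ?num_real. Qed.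

Lemma rnorm_nat n : rnorm (n%:R : R[i]) = n%:R.
Proof. by rewrite -(rmorph_nat (real_complex R)) rnorm_real normr_nat. Qed.

Lemma rnormi : rnorm ('i : R[i]) = 1.
Proof. by apply/eqP; rewrite -(@eqrXn2 _ 2) ?rnorm_ge0// sqr_rnorm /= expr0n add0r. Qed.

Lemma ger_Re_rnorm z : `|complex.Re z| <= rnorm z.
Proof.
rewrite -(@ler_pXn2r _ 2) ?nnegrE ?rnorm_ge0// sqr_rnorm real_normK ?num_real//.
by rewrite lerDl sqr_ge0.
Qed.

Lemma ger_Im_rnorm z : `|complex.Im z| <= rnorm z.
Proof.
rewrite -(@ler_pXn2r _ 2) ?nnegrE ?rnorm_ge0// sqr_rnorm real_normK ?num_real//.
by rewrite lerDr sqr_ge0.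
Qed.

Lemma rnorm_le_Re_Im z : rnorm z <= `|complex.Re z| + `|complex.Im z|.
Proof.
rewrite -(@ler_pXn2r _ 2) ?nnegrE ?rnorm_ge0 ?addr_ge0// sqr_rnorm.
rewrite -(real_normK (num_real (complex.Re z))) -(real_normK (num_real (complex.Im z))).
by rewrite sqrrD lerD2r lerDl mulrn_wge0// mulr_ge0.
Qed.

Lemma ReD z w : complex.Re (z + w) = complex.Re z + complex.Re w.
Proof. by case: z w => [a b] [c d]. Qed.

Lemma ImD z w : complex.Im (z + w) = complex.Im z + complex.Im w.
Proof. by case: z w => [a b] [c d]. Qed.

Lemma ReN z : complex.Re (- z) = - complex.Re z.
Proof. by case: z. Qed.

Lemma ImN z : complex.Im (- z) = - complex.Im z.
Proof. by case: z. Qed.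

Lemma Re_mulr (r : R) z : complex.Re (r%:C * z) = r * complex.Re z.
Proof. by case: z => a b /=; rewrite mul0r subr0. Qed.

Lemma Im_mulr (r : R) z : complex.Im (r%:C * z) = r * complex.Im z.
Proof. by case: z => a b /=; rewrite mul0r addr0. Qed.

Lemma conjc_realM (r : R) z : conjc (r%:C * z) = r%:C * conjc z.
Proof. by case: z => a b; simpc. Qed.

Lemma Re_sum I (r : seq I) (P : pred I) (F : I -> R[i]) :
  complex.Re (\sum_(i <- r | P i) F i) = \sum_(i <- r | P i) complex.Re (F i).
Proof. by elim/big_ind2 : _ => // a x b y <- <-; rewrite ReD. Qed.

End RealNorm.

Section Dot.
Context {R : realType} {H : completeNormedModType R[i]}.
Variable ip : {dot H for conjC}.
Hypothesis Hip : norm_from_dot ip.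
Implicit Types (u v : H) (a : R[i]).

Lemma ipC u v : ip u v = conjc (ip v u).
Proof. by rewrite hermC expr0 mul1r. Qed.

Lemma ip_rnorm u : ip u u = (rnorm u ^+ 2)%:C.
Proof. by rewrite -Hip rnormE rmorphXn. Qed.

Lemma ipDl u v w : ip (u + v) w = ip u w + ip v w.
Proof. by rewrite linearDl. Qed.
Lemma ipDr u v w : ip u (v + w) = ip u v + ip u w.
Proof. by rewrite linearDr. Qed.
Lemma ipNl u w : ip (- u) w = - ip u w.
Proof. by rewrite linearNl. Qed.
Lemma ipNr u w : ip u (- w) = - ip u w.
Proof. by rewrite linearNr. Qed.
Lemma ipZl a u w : ip (a *: u) w = a * ip u w.
Proof. by rewrite linearZl_LR. Qed.
Lemma ipZr a u w : ip u (a *: w) = conjc a * ip u w.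
Proof. by rewrite linearZr_LR. Qed.
Lemma ip0l w : ip 0 w = 0.
Proof. by rewrite linear0l. Qed.
Lemma ip0r w : ip w 0 = 0.
Proof. by rewrite linear0r. Qed.
Lemma ip_suml I (r : seq I) (P : pred I) (F : I -> H) w :
  ip (\sum_(i <- r | P i) F i) w = \sum_(i <- r | P i) ip (F i) w.
Proof. by elim/big_ind2 : _ => //= [|? ? ? ? <- <-]; rewrite ?ip0l ?ipDl. Qed.
Lemma ip_sumr I (r : seq I) (P : pred I) (F : I -> H) w :
  ip w (\sum_(i <- r | P i) F i) = \sum_(i <- r | P i) ip w (F i).
Proof. by elim/big_ind2 : _ => //= [|? ? ? ? <- <-]; rewrite ?ip0r ?ipDr. Qed.

Lemma rnorm_sqrD u v :
  rnorm (u + v) ^+ 2 = rnorm u ^+ 2 + rnorm v ^+ 2 + complex.Re (ip u v) *+ 2.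
Proof.
have := ip_rnorm (u + v).
rewrite ipDl !ipDr (ipC v u) !ip_rnorm => /(congr1 (@complex.Re R)) /= <-.
by rewrite !ReD /=; case: (ip u v) => a b /=; ring.
Qed.

Lemma rnorm_sqrB u v :
  rnorm (u - v) ^+ 2 = rnorm u ^+ 2 + rnorm v ^+ 2 - complex.Re (ip u v) *+ 2.
Proof. by rewrite rnorm_sqrD rnormN ipNr ReN mulNrn. Qed.

Lemma rnorm_ip_le u v : rnorm (ip u v) <= rnorm u * rnorm v.
Proof.
have [->|v0] := eqVneq v 0; first by rewrite ip0r !rnorm0 mulr0.
have vp : 0 < rnorm v ^+ 2.
  by rewrite exprn_gt0// lt_def rnorm_eq0 v0 rnorm_ge0.
rewrite -(@ler_pXn2r _ 2) ?nnegrE ?mulr_ge0 ?rnorm_ge0//.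
(* [c *: v] is the orthogonal projection of [u] onto the line of [v]; the inequality is the
   nonnegativity of the squared residual. *)
pose c := ((rnorm v ^+ 2)^-1)%:C * ip u v.
have := sqr_ge0 (rnorm (u - c *: v)); rewrite rnorm_sqrB ipZr rnormZ.
have -> : conjc c * ip u v = ((rnorm (ip u v) ^+ 2) / rnorm v ^+ 2)%:C.
  rewrite /c. rewrite conjc_realM -mulrA mulrC [conjc _ * _]mulrC -sqr_normc rnormE.
  by rewrite -rmorphXn -rmorphM.
rewrite /c rnormM (rnorm_real (_ ^-1)) ger0_norm ?invr_ge0 ?sqr_ge0//= => h.
rewrite exprMn -ler_pdivrMr//.
move: h; rewrite !exprMn; set a := rnorm (ip u v); set b := rnorm v ^+ 2.
have -> : b^-1 ^+ 2 * a ^+ 2 * b = a ^+ 2 / b by field; rewrite gt_eqF.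
lra.
Qed.

Lemma rnorm_sum_orthogonal n (F : 'I_n -> H) :
  (forall i j, i != j -> ip (F i) (F j) = 0) ->
  rnorm (\sum_i F i) ^+ 2 = \sum_i rnorm (F i) ^+ 2.
Proof.
move=> o; apply: complexI; rewrite -ip_rnorm ip_suml rmorph_sum /=.
apply: eq_bigr => i _; rewrite ip_sumr (bigD1 i)//= ip_rnorm.
by rewrite big1 ?addr0// => j ji; rewrite o// eq_sym.
Qed.

End Dot.

(* Restatements of [linearD] and its kin whose right-hand sides are written
   with the coercion of the left-hand side, so that they chain by rewriting. *)
Section LinearOperators.
Context {R : realType} {H : completeNormedModType R[i]} (F : {linear H -> H}).

Lemma linD u v : F (u + v) = F u + F v. Proof. exact: linearD. Qed.
Lemma linN u : F (- u) = - F u. Proof. exact: linearN. Qed.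
Lemma linB u v : F (u - v) = F u - F v. Proof. exact: linearB. Qed.
Lemma linZ a u : F (a *: u) = a *: F u. Proof. exact: linearZ. Qed.
Lemma lin0 : F 0 = 0. Proof. exact: linear0. Qed.
Lemma lin_sum I (r : seq I) (P : pred I) (G : I -> H) :
  F (\sum_(i <- r | P i) G i) = \sum_(i <- r | P i) F (G i).
Proof. exact: linear_sum. Qed.

End LinearOperators.

(** * The Carleson embedding for finitely many atoms *)

Section FiniteSums.
Context {R : realType} {I : finType}.
Implicit Types f g : I -> R.

Lemma sqr_sum f : (\sum_i f i) ^+ 2 = \sum_i \sum_j f i * f j.
Proof. by rewrite expr2 big_distrl /=; apply: eq_bigr => i _; rewrite big_distrr. Qed.

(** By Lagrange's identity, twice the difference of the two sides is a double sum of squares. *)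
Lemma cauchy_sum f g :
  (\sum_i f i * g i) ^+ 2 <= (\sum_i f i ^+ 2) * (\sum_i g i ^+ 2).
Proof.
rewrite sqr_sum big_distrl /=.
under [leRHS]eq_bigr do rewrite big_distrr /=.
have h : 0 <= \sum_i \sum_j (f i * g j - f j * g i) ^+ 2.
  by do 2 apply: sumr_ge0 => ? _; exact: sqr_ge0.
suff e : \sum_i \sum_j (f i * g j - f j * g i) ^+ 2 =
    (\sum_i \sum_j f i ^+ 2 * g j ^+ 2) *+ 2 -
    (\sum_i \sum_j f i * g i * (f j * g j)) *+ 2 by lra.
have -> : (\sum_i \sum_j f i ^+ 2 * g j ^+ 2) *+ 2 =
    \sum_i \sum_j (f i ^+ 2 * g j ^+ 2 + f j ^+ 2 * g i ^+ 2).
  under [RHS]eq_bigr do rewrite big_split.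
  by rewrite big_split /= [X in _ = _ + X]exchange_big mulr2n.
rewrite -sumrMnl -sumrB; apply: eq_bigr => i _.
by rewrite -sumrMnl -sumrB; apply: eq_bigr => j _; ring.
Qed.

(* With X = <L^T f, f>, the hypothesis says that |L^T f|^2 <= 2 c X. *)
Lemma schur_selfdominated (L : I -> I -> R) f (c : R) :
    (forall i j, 0 <= L i j) -> (forall i, 0 <= f i) -> 0 <= c ->
    (forall i k, \sum_j L i j * L k j <= c * (L i k + L k i)) ->
  \sum_i \sum_j L i j * (f i * f j) <= 2 * c * \sum_i f i ^+ 2.
Proof.
move=> L0 f0 c0 LL.
set X := (X in X <= _); pose g j := \sum_i L i j * f i.
have X0 : 0 <= X by do 2 apply: sumr_ge0 => ? _; rewrite !mulr_ge0.
have XE : X = \sum_j g j * f j.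
  rewrite /X exchange_big; apply: eq_bigr => j _ /=.
  by rewrite big_distrl; apply: eq_bigr => i _ /=; ring.
have G : \sum_j g j ^+ 2 <= 2 * c * X.
  have -> : \sum_j g j ^+ 2 = \sum_i \sum_k (\sum_j L i j * L k j) * (f i * f k).
    under eq_bigr do rewrite sqr_sum.
    rewrite exchange_big; apply: eq_bigr => i _ /=.
    rewrite exchange_big; apply: eq_bigr => k _ /=.
    by rewrite big_distrl; apply: eq_bigr => j _ /=; ring.
  have -> : 2 * c * X = \sum_i \sum_k (c * (L i k + L k i)) * (f i * f k).
    have -> : 2 * c * X = c * X + c * X by ring.
    rewrite {2}/X exchange_big /= big_distrr big_distrr -big_split /=.
    apply: eq_bigr => i _; rewrite big_distrr big_distrr -big_split /=.
    by apply: eq_bigr => k _; ring.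
  by do 2 apply: ler_sum => ? _; rewrite ler_wpM2r// mulr_ge0.
have F0 : 0 <= \sum_i f i ^+ 2 by apply: sumr_ge0 => i _; exact: sqr_ge0.
(* Cauchy-Schwarz and [G] give X^2 <= 2 c X |f|^2; a positive X then cancels. *)
have := cauchy_sum g f; rewrite -XE => h.
have [X00|Xp] := leP X 0; first by rewrite (le_trans X00)// !mulr_ge0.
rewrite -(ler_pM2l Xp) -expr2 (le_trans h)//.
by rewrite mulrA [X * _]mulrC ler_wpM2r.
Qed.

End FiniteSums.

(** * The quasi-metric |1 - conj z w| on the closed disc *)

Section Carleson.
Context {R : realType}.
Implicit Types z w : R[i].

Definition disc_dist z w : R := rnorm (1 - conjc z * w).

Lemma disc_distC z w : disc_dist z w = disc_dist w z.
Proof.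
rewrite /disc_dist -[LHS]rnormJ; congr rnorm.
by case: z w => [a b] [c d]; simpc => /=; congr Complex; ring.
Qed.

Lemma sqr_disc_dist z w :
  disc_dist z w ^+ 2 = rnorm (z - w) ^+ 2 + (1 - rnorm z ^+ 2) * (1 - rnorm w ^+ 2).
Proof. by rewrite /disc_dist !sqr_rnorm; case: z w => [a b] [c d] /=; ring. Qed.

Lemma disc_dist_ge z w : rnorm w <= 1 -> 1 - rnorm z <= disc_dist z w.
Proof.
move=> w1; have : rnorm (1 : R[i]) <= rnorm (1 - conjc z * w) + rnorm (conjc z * w).
  by rewrite -[in leLHS](subrK (conjc z * w) 1) rnormD.
rewrite rnorm1 rnormM rnormJ -/(disc_dist z w).
have := rnorm_ge0 z; nra.
Qed.

Lemma disc_dist_gt0 z w : rnorm z < 1 -> rnorm w <= 1 -> 0 < disc_dist z w.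
Proof. by move=> z1 w1; apply: lt_le_trans (disc_dist_ge z w1); rewrite subr_gt0. Qed.

Lemma disc_dist_ge_dist z w : rnorm z <= 1 -> rnorm w <= 1 ->
  rnorm (z - w) <= disc_dist z w.
Proof.
move=> z1 w1; rewrite -(@ler_pXn2r _ 2) ?nnegrE ?rnorm_ge0// sqr_disc_dist.
by rewrite lerDl mulr_ge0// subr_ge0 exprn_ile1 ?rnorm_ge0.
Qed.

(** Writing a and b for the two distances to [y]: the distance from [x] to [z] is at most (1 -
    |x|^2) + |x - z|, where the first term is at most 2 a and the second at most a + b. The constant
    10 is 3^2 + 1^2, from squaring 3 a + b. *)
Lemma disc_dist_quasi_triangle x y z :
    rnorm x <= 1 -> rnorm y <= 1 -> rnorm z <= 1 ->
  disc_dist x z ^+ 2 <= 10 * (disc_dist x y ^+ 2 + disc_dist z y ^+ 2).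
Proof.
move=> x1 y1 z1.
have h1 : disc_dist x z <= (1 - rnorm x ^+ 2) + rnorm (x - z).
  have -> : disc_dist x z = rnorm ((1 - rnorm x ^+ 2)%:C + conjc x * (x - z)).
    congr rnorm; rewrite sqr_rnorm.
    by case: x z {x1 z1} => [a b] [c d]; simpc => /=; congr Complex; ring.
  rewrite (le_trans (rnormD _ _))// lerD//.
    by rewrite rnorm_real ger0_norm// subr_ge0 exprn_ile1 ?rnorm_ge0.
  by rewrite rnormM rnormJ ler_piMl ?rnorm_ge0.
have h2 : rnorm (x - z) <= rnorm (x - y) + rnorm (z - y).
  by rewrite (rnorm_distC z) (le_trans _ (rnormD _ _))// addrA subrK.
have := disc_dist_ge x y1; have := disc_dist_ge_dist x1 y1.
have := disc_dist_ge_dist z1 y1.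
move: h1 h2 (rnorm_ge0 x) x1 (rnorm_ge0 (1 - conjc x * z)).
rewrite -/(disc_dist x z).
move: (disc_dist x z) (disc_dist x y) (disc_dist z y) (rnorm x) (rnorm _) (rnorm _) (rnorm _).
move=> D a b r s t u h1 h2 r0 r1 D0 ub ta ra.
have : D <= 3 * a + b by nra.
move=> h; have := sqr_ge0 (a - 3 * b).
have : D ^+ 2 <= (3 * a + b) ^+ 2 by rewrite ler_pXn2r ?nnegrE//; lra.
lra.
Qed.

End Carleson.

Section FiniteCarleson.
Context {R : realType}.

(** Discards the geometric remainders of the Szego series and of the iterated resolvent equation. *)
Lemma ler_geometric_error (X Y c rho : R) (n0 : nat) : 0 <= rho < 1 ->
  (forall n, (n0 <= n)%N -> X <= Y + c * rho ^+ n) -> X <= Y.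
Proof.
move=> /andP[r0 r1] h.
have lim : Y + c * rho ^+ n @[n --> \oo] --> Y + c * 0.
  by apply: cvgD; [exact: cvg_cst|apply: cvgMr; apply: cvg_expr; rewrite ger0_norm].
rewrite mulr0 addr0 in lim.
apply: (@ler_cvg_to _ _ _ _ (fun=> X) _ _ _ (cvg_cst X) lim).
by exists n0 => // n /= /h.
Qed.

Lemma sqr_rnormE (z : R[i]) : rnorm z ^+ 2 = complex.Re (conjc z * z).
Proof. by rewrite sqr_rnorm; case: z => x y /=; ring. Qed.

(** 1 / (1 - q) is the mean of 1 and (1 + q) / (1 - q), and the real part of the latter is the
    Poisson kernel. *)
Lemma Re_inv1B (q : R[i]) : q != 1 ->
  complex.Re (1 - q)^-1 =
    2^-1 * (1 + (1 - rnorm q ^+ 2) / rnorm (1 - q) ^+ 2).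
Proof.
move=> q1; have : rnorm (1 - q) ^+ 2 != 0.
  by rewrite sqrf_eq0 rnorm_eq0 subr_eq0 eq_sym.
rewrite !sqr_rnorm; case: q {q1} => [a b] /= d0.
set d := _ + (0 - b) ^+ 2 in d0 *; set x := _ - (a ^+ 2 + _).
have -> : 1 + x / d = (d + x) / d by rewrite [RHS]mulrDl divff.
by rewrite mulrA; congr (_ / _); rewrite /d /x; field.
Qed.

(** * Real weights and the real part of the Szego kernel *)

Section RealWeights.
Context {I : finType}.
Variables (w : I -> R[i]) (a : I -> R) (rho : R).
Hypothesis w_rho : forall i, rnorm (w i) <= rho.
Hypothesis rho1 : rho < 1.

Let q i j := conjc (w i) * w j.

Let q_rho i j : rnorm (q i j) <= rho ^+ 2.
Proof. by rewrite rnormM rnormJ expr2 ler_pM ?rnorm_ge0. Qed.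

(** Real weights come out of the real part, so that only the real part of the kernel enters; this is
    why complex weights are treated separately. *)
Lemma sum_geometric_kernel n :
  \sum_(k < n) rnorm (\sum_i (a i)%:C * w i ^+ k) ^+ 2 =
  \sum_i \sum_j a i * a j * complex.Re (\sum_(k < n) q i j ^+ k).
Proof.
have e k : rnorm (\sum_i (a i)%:C * w i ^+ k) ^+ 2 =
    \sum_i \sum_j a i * a j * complex.Re (q i j ^+ k).
  rewrite sqr_rnormE rmorph_sum /= big_distrl Re_sum; apply: eq_bigr => i _.
  rewrite big_distrr Re_sum; apply: eq_bigr => j _ /=.
  rewrite -Re_mulr; congr complex.Re.
  by rewrite /q exprMn conjc_realM (rmorphXn (@conjc R)) [RHS]mulrA rmorphM; ring.
under eq_bigr do rewrite e.
rewrite exchange_big /=; apply: eq_bigr => i _.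
rewrite exchange_big /=; apply: eq_bigr => j _.
by rewrite -big_distrr /= Re_sum.
Qed.

Lemma q_neq1 i j : q i j != 1.
Proof.
apply/eqP => e; have := q_rho i j; rewrite e rnorm1.
have := le_trans (rnorm_ge0 _) (w_rho i) => r0.
by apply/negP; rewrite -ltNge expr_lt1.
Qed.

Lemma normr_Re_geometric i j n :
  `|complex.Re (\sum_(k < n) q i j ^+ k) - complex.Re (1 - q i j)^-1| <=
    rnorm (1 - q i j)^-1 * (rho ^+ 2) ^+ n.
Proof.
have u : 1 - q i j != 0 by rewrite subr_eq0 eq_sym q_neq1.
have -> : \sum_(k < n) q i j ^+ k = (1 - q i j)^-1 - (1 - q i j)^-1 * q i j ^+ n.
  apply: (mulfI u); rewrite mulrBr mulrA mulfV// mul1r.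
  by rewrite -[LHS]opprK -mulNr opprB -subrX1 opprB.
rewrite ReD addrAC subrr add0r (le_trans (ger_Re_rnorm _))// rnormN rnormM rnormX.
by rewrite ler_wpM2l ?rnorm_ge0// lerXn2r ?nnegrE ?rnorm_ge0 ?sqr_ge0.
Qed.

Lemma sum_geometric_kernel_le n :
  \sum_(k < n) rnorm (\sum_i (a i)%:C * w i ^+ k) ^+ 2 <=
  \sum_i \sum_j `|a i| * `|a j| * `|complex.Re (1 - q i j)^-1|.
Proof.
(* A point is needed to know that [rho] is nonnegative; without one both sides vanish. *)
have [e _|i0] := pickP (@predT I); last first.
  rewrite [leRHS]big1 => [|i]; last by have := i0 i.
  rewrite big1// => k _; rewrite big1 ?rnorm0 ?expr0n// => i.
  by have := i0 i.
have r0 : 0 <= rho := le_trans (rnorm_ge0 _) (w_rho e).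
pose c := \sum_i \sum_j `|a i| * `|a j| * rnorm (1 - q i j)^-1.
(* The left side increases with the number of terms, so it may be replaced by the sum of [N >= n]
   terms, with [N] tending to infinity. *)
apply: (ler_geometric_error (c := c) (rho := rho ^+ 2) (n0 := n)).
  by rewrite sqr_ge0 expr_lt1.
move=> N nN.
apply: (@le_trans _ _ (\sum_(k < N) rnorm (\sum_i (a i)%:C * w i ^+ k) ^+ 2)).
  rewrite -!(big_mkord xpredT (fun k => rnorm (\sum_i (a i)%:C * w i ^+ k) ^+ 2)).
  by rewrite [leRHS](big_cat_nat (leq0n n) nN)/= lerDl sumr_ge0// => k _; exact: sqr_ge0.
rewrite sum_geometric_kernel big_distrl -big_split /=; apply: ler_sum => i _.
rewrite big_distrl -big_split /=; apply: ler_sum => j _.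
rewrite (le_trans (ler_norm _))// normrM normrM -(mulrA _ (rnorm _)) -mulrDr.
rewrite ler_wpM2l ?mulr_ge0//.
rewrite -[X in `|X|](subrK (complex.Re (1 - q i j)^-1)) (le_trans (ler_normD _ _))//.
by rewrite addrC lerD2l normr_Re_geometric.
Qed.

(** In the Poisson kernel the numerator is 1 - s t with s, t the squared moduli, and (1 - s) (1 - t)
    >= 0 gives 1 - s t <= (1 - s) + (1 - t). *)
Lemma normr_Re_inv i j : `|complex.Re (1 - q i j)^-1| <=
  2^-1 * (1 + ((1 - rnorm (w i) ^+ 2) + (1 - rnorm (w j) ^+ 2)) /
              disc_dist (w i) (w j) ^+ 2).
Proof.
have wi k : rnorm (w k) ^+ 2 <= 1.
  by rewrite exprn_ile1 ?rnorm_ge0// (le_trans (w_rho k))// ltW.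
rewrite Re_inv1B ?q_neq1// ger0_norm.
  rewrite ler_wpM2l// lerD2l ler_wpM2r ?invr_ge0 ?sqr_ge0// /q rnormM rnormJ exprMn.
  have := wi i; have := wi j; have := sqr_ge0 (rnorm (w i)); have := sqr_ge0 (rnorm (w j)).
  nra.
rewrite mulr_ge0// addr_ge0// mulr_ge0 ?invr_ge0 ?sqr_ge0// subr_ge0.
by rewrite /q rnormM rnormJ exprMn mulr_ile1 ?sqr_ge0.
Qed.

End RealWeights.

(** * Embedding estimate for atoms of mass [m] at the points [w], with dual masses [t] *)

Section Embedding.
Context {I : finType}.
Variables (w : I -> R[i]) (m t : I -> R) (rho K : R).
Hypothesis w_rho : forall i, rnorm (w i) <= rho.
Hypothesis rho1 : rho < 1.
Hypothesis m0 : forall i, 0 <= m i.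
Hypothesis t0 : forall i, 0 <= t i.
Hypothesis kernel_test : forall i,
  \sum_j m j * ((1 - rnorm (w i) ^+ 2) / disc_dist (w i) (w j) ^+ 2) <= K.

Let s i : R := Num.sqrt (m i).
Let f i : R := Num.sqrt (t i).
Let h i : R := 1 - rnorm (w i) ^+ 2.
Let D i j : R := disc_dist (w i) (w j) ^+ 2.

Let wi k : rnorm (w k) <= 1.
Proof. by rewrite (le_trans (w_rho k))// ltW. Qed.

Let h_gt0 k : 0 < h k.
Proof.
by rewrite subr_gt0 expr_lt1 ?rnorm_ge0// (le_lt_trans (w_rho k)).
Qed.

Let D_gt0 i j : 0 < D i j.
Proof. by rewrite exprn_gt0// disc_dist_gt0// (le_lt_trans (w_rho i)). Qed.

(** The Schur test [schur_selfdominated] applies with [c = 10 * K]: dividing the quasi-triangle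
    inequality by [D i j * D k j * D i k] splits 1 / (D_ij D_kj) into a sum of two terms over D_ik,
    and [kernel_test] bounds the sum over [j] of each. *)
Lemma poisson_schur : \sum_i \sum_j s i * s j * (h i / D i j) * (f i * f j) <=
  20 * K * \sum_i t i.
Proof.
have [e _|i0] := pickP (@predT I); last by rewrite !big1 ?mulr0// => i; have := i0 i.
have K0 : 0 <= K.
  apply: le_trans (kernel_test e); apply: sumr_ge0 => j _.
  by apply: mulr_ge0 => //; apply: divr_ge0; [exact: ltW (h_gt0 _)|exact: ltW (D_gt0 _ _)].
have -> : \sum_i t i = \sum_i f i ^+ 2 by apply: eq_bigr => i _; rewrite sqr_sqrtr.
have -> : 20 * K = 2 * (10 * K) by ring.
apply: schur_selfdominated.
- by move=> i j; rewrite !mulr_ge0 ?sqrtr_ge0 ?invr_ge0 ?(ltW (h_gt0 _)) ?(ltW (D_gt0 _ _)).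
- by move=> i; exact: sqrtr_ge0.
- by rewrite mulr_ge0.
move=> i k.
have test l : h l * \sum_j m j / D l j <= K.
  rewrite big_distrr /= (le_trans _ (kernel_test l))//; apply: ler_sum => j _.
  by rewrite [leLHS]mulrCA.
have LLj j : s i * s j * (h i / D i j) * (s k * s j * (h k / D k j)) <=
    10 * s i * s k / D i k * (h k * (h i * (m j / D i j)) + h i * (h k * (m j / D k j))).
  have -> : s i * s j * (h i / D i j) * (s k * s j * (h k / D k j)) =
      s i * s k * (h i * h k) * m j * ((D i j)^-1 * (D k j)^-1).
    by rewrite -(sqr_sqrtr (m0 j)) -/(s j); ring.
  have -> : 10 * s i * s k / D i k *
      (h k * (h i * (m j / D i j)) + h i * (h k * (m j / D k j))) =
      s i * s k * (h i * h k) * m j * (10 * ((D i j)^-1 + (D k j)^-1) / D i k) by ring.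
  rewrite ler_wpM2l//; first by rewrite !mulr_ge0 ?sqrtr_ge0 ?invr_ge0 ?(ltW (h_gt0 _)) ?(ltW (D_gt0 _ _)).
  rewrite ler_pdivlMr//.
  have -> : (D i j)^-1 * (D k j)^-1 * D i k = D i k / (D i j * D k j).
    by rewrite [LHS]mulrC [(_ * D k j)^-1]invfM.
  rewrite ler_pdivrMr; last exact: mulr_gt0 (D_gt0 _ _) (D_gt0 _ _).
  have -> : 10 * ((D i j)^-1 + (D k j)^-1) * (D i j * D k j) = 10 * (D i j + D k j).
    by field; rewrite !(gt_eqF (D_gt0 _ _)).
  exact: disc_dist_quasi_triangle.
have LLsum := ler_sum (index_enum I) (P := xpredT) (fun j _ => LLj j).
apply: le_trans LLsum _.
rewrite -big_distrr big_split /= -!big_distrr /=.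
have Dki : D k i = D i k by rewrite /D disc_distC.
have -> : 10 * K * (s i * s k * (h i / D i k) + s k * s i * (h k / D k i)) =
   10 * s i * s k / D i k * (h k * K + h i * K) by rewrite Dki; ring.
rewrite ler_wpM2l//; first by rewrite !mulr_ge0 ?sqrtr_ge0 ?invr_ge0 ?(ltW (h_gt0 _)) ?(ltW (D_gt0 _ _)).
by rewrite lerD// ler_wpM2l// (ltW (h_gt0 _)).
Qed.

Lemma real_carleson (a : I -> R) n : (forall i, a i ^+ 2 <= m i * t i) ->
  \sum_(k < n) rnorm (\sum_i (a i)%:C * w i ^+ k) ^+ 2 <=
    (2^-1 * \sum_i m i + 20 * K) * \sum_i t i.
Proof.
move=> am; apply: le_trans (sum_geometric_kernel_le _ w_rho rho1 _) _.
have as_f i : `|a i| <= s i * f i.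
  rewrite -(@ler_pXn2r _ 2) ?nnegrE ?mulr_ge0 ?sqrtr_ge0//.
  by rewrite real_normK ?num_real// exprMn !sqr_sqrtr.
apply: (@le_trans _ _ (\sum_i \sum_j (s i * f i) * (s j * f j) *
   (2^-1 * (1 + (h i + h j) / D i j)))).
  apply: ler_sum => i _; apply: ler_sum => j _.
  apply: ler_pM => //; [exact: ler_pM|exact: (normr_Re_inv w_rho rho1)].
have -> : \sum_i \sum_j (s i * f i) * (s j * f j) * (2^-1 * (1 + (h i + h j) / D i j)) =
  2^-1 * (\sum_i s i * f i) ^+ 2 +
  \sum_i \sum_j s i * s j * (h i / D i j) * (f i * f j).
  (* Exchanging [i] and [j] turns the [h j] half into the [h i] half; the two equal sums absorb the
     factor 1/2. *)
  set X := (X in _ = _ + X).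
  have -> : X = 2^-1 * X + 2^-1 * X by field.
  rewrite sqr_sum {2}/X [in X in _ = _ + (_ + X)]exchange_big /= !big_distrr -!big_split /=.
  apply: eq_bigr => i _; rewrite !big_distrr -!big_split /=.
  apply: eq_bigr => j _.
  have -> : D j i = D i j by rewrite /D disc_distC.
  ring.
rewrite mulrDl lerD ?poisson_schur// -mulrA ler_wpM2l//.
rewrite (le_trans (cauchy_sum _ _))//.
by rewrite le_eqVlt; apply/orP; left; apply/eqP; congr (_ * _); apply: eq_bigr => i _;
  rewrite sqr_sqrtr.
Qed.

(** Real and imaginary parts of [g] are real weights under the same bound; |u + i v|^2 <= 2 |u|^2 +
    2 |v|^2 makes the constant four times that of [real_carleson]. *)
Lemma finite_carleson (g : I -> R[i]) n :
  (forall i, rnorm (g i) ^+ 2 <= m i * t i) ->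
  \sum_(k < n) rnorm (\sum_i g i * w i ^+ k) ^+ 2 <=
    (2 * \sum_i m i + 80 * K) * \sum_i t i.
Proof.
move=> gm.
have gR i : complex.Re (g i) ^+ 2 <= m i * t i.
  by apply: le_trans (gm i); rewrite sqr_rnorm lerDl sqr_ge0.
have gI i : complex.Im (g i) ^+ 2 <= m i * t i.
  by apply: le_trans (gm i); rewrite sqr_rnorm lerDr sqr_ge0.
have := real_carleson n gR; have := real_carleson n gI.
set S := (X in _ <= X); set A := (X in X <= _) => hA; set B := (X in X <= _) => hB.
have -> : (2 * \sum_i m i + 80 * K) * \sum_i t i = 2 * S + 2 * S by rewrite /S; field.
apply: (@le_trans _ _ (2 * B + 2 * A)); last by rewrite lerD// ler_wpM2l.
rewrite !big_distrr -big_split; apply: ler_sum => k _ /=.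
have -> : \sum_i g i * w i ^+ k = \sum_i (complex.Re (g i))%:C * w i ^+ k +
    'i%C * \sum_i (complex.Im (g i))%:C * w i ^+ k.
  rewrite big_distrr -big_split; apply: eq_bigr => i _ /=.
  by rewrite {1}(complexE (g i)); ring.
set u := \sum_i _; set v := \sum_i _.
have := rnormD u ('i%C * v); rewrite rnormM rnormi mul1r => h1.
have h2 : rnorm (u + 'i%C * v) ^+ 2 <= (rnorm u + rnorm v) ^+ 2.
  by rewrite ler_pXn2r ?nnegrE ?addr_ge0 ?rnorm_ge0.
have := sqr_ge0 (rnorm u - rnorm v); lra.
Qed.

End Embedding.
End FiniteCarleson.

(** * Borel sets of the complex plane *)

Section BorelComplex.
Context {R : realType}.

(** A 1-Lipschitz function pulls open intervals back to open sets; [Re], [Im] and the distance to a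
    point are all of this kind. *)
Lemma measurable_lipschitz (f : R[i] -> R) :
  (forall z w, `|f z - f w| <= rnorm (z - w)) ->
  measurable_fun [set: borelC R] (f : borelC R -> R).
Proof.
move=> fl; apply: (measurability _ (RGenOpens.measurableE R)).
move=> _ [_ [a [b ->]] <-]; rewrite setTI; apply: sub_sigma_algebra.
rewrite /= openE => z Uz.
have : open (`]a, b[%classic : set R) by exact: interval_open.
rewrite openE => /(_ _ Uz).
move=> /nbhs_ballP[e /= e0 sub].
apply/nbhs_ballP; exists e%:C => /=; first by rewrite ltcR.
move=> w; rewrite -ball_normE /= => zw; apply: sub; rewrite -ball_normE /=.
by rewrite (le_lt_trans (fl z w))// -ltcR -rnormE.
Qed.

Lemma measurable_Re :
  measurable_fun [set: borelC R] ((@complex.Re R) : borelC R -> R).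
Proof.
by apply: measurable_lipschitz => z w; rewrite -ReN -ReD ger_Re_rnorm.
Qed.

Lemma measurable_Im :
  measurable_fun [set: borelC R] ((@complex.Im R) : borelC R -> R).
Proof.
by apply: measurable_lipschitz => z w; rewrite -ImN -ImD ger_Im_rnorm.
Qed.

Lemma measurable_rnormB (c : R[i]) :
  measurable_fun [set: borelC R] ((fun z => rnorm (c - z)) : borelC R -> R).
Proof.
apply: measurable_lipschitz => z w.
have h (x y : R[i]) : rnorm (c - x) - rnorm (c - y) <= rnorm (x - y).
  rewrite lerBlDl (rnorm_distC x) (le_trans _ (rnormD _ _))//.
  by rewrite addrA subrK.
rewrite ler_norml; apply/andP; split; last exact: h.
by rewrite lerNl opprB [leRHS]rnorm_distC; exact: h.
Qed.

Definition disc (c : R[i]) (r : R) : set (borelC R) :=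
  [set z : R[i] | rnorm (c - z) < r].

Definition cdisc (c : R[i]) (r : R) : set (borelC R) :=
  [set z : R[i] | rnorm (c - z) <= r].

Lemma measurable_disc c r : measurable (disc c r).
Proof.
rewrite -[disc c r]setTI.
have := @measurable_rnormB c measurableT `]-oo, r[%classic (measurable_itv _).
by congr measurable; apply/seteqP; split => z /=; rewrite in_itv.
Qed.

Lemma measurable_cdisc c r : measurable (cdisc c r).
Proof.
rewrite -[cdisc c r]setTI.
have := @measurable_rnormB c measurableT `]-oo, r]%classic (measurable_itv _).
by congr measurable; apply/seteqP; split => z /=; rewrite in_itv.
Qed.

Lemma cdisc0E r : [set z : R[i] | rnorm z <= r] = cdisc 0 r :> set (borelC R).
Proof. by apply/seteqP; split => z /=; rewrite /cdisc /= sub0r rnormN. Qed.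

Lemma measurable_closed_unit_disc : measurable (closed_unit_disc (R := R)).
Proof. rewrite /closed_unit_disc cdisc0E; exact: measurable_cdisc. Qed.

Lemma ballCE (z : R[i]) (r : R) : ball (z : R[i]^o) r%:C = disc z r.
Proof.
by apply/seteqP; split => w; rewrite -ball_normE /disc /= rnormE ltcR.
Qed.

Lemma integral_support (mu : {measure set (borelC R) -> \bar R})
    (f : borelC R -> R) (S : set (borelC R)) :
  measurable_fun [set: borelC R] f -> measurable S -> mu (~` S) = 0%E ->
  (\int[mu]_(x in setT) (f x)%:E = \int[mu]_(x in S) (f x)%:E)%E.
Proof.
move=> mf mS S0; rewrite [RHS]integral_mkcond.
have mF : measurable_fun [set: borelC R] (fun x : borelC R => (f x)%:E) by exact/measurable_EFinP.
apply: ae_eq_integral => //.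
  apply/(measurable_restrictT _ mS).
  exact: measurable_funS mF.
exists (~` S); split => //; first exact: measurableC.
move=> x /= h Sx; apply: h => _; rewrite patchE ifT//; exact/mem_set.
Qed.

End BorelComplex.

(** * Projection-valued measures *)

Section RnormLimits.
Context {R : realType} {V : normedModType R[i]}.

(** Positive elements of [R[i]] are real, so real radii suffice to test convergence. *)
Lemma cvg_rnormP (y : nat -> V) (l : V) : y @ \oo --> l <->
  forall e : R, 0 < e -> \forall n \near \oo, rnorm (l - y n) <= e.
Proof.
split=> [/cvgrPdist_le h e e0|h].
  have := h e%:C; rewrite ltcR => /(_ e0).
  by apply: filterS => n; rewrite rnormE lecR.
apply/cvgrPdist_le => e e0.
have er : e = (complex.Re e)%:C by rewrite RRe_real// realE ltW.
have : 0 < complex.Re e by rewrite -ltcR -er.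
by move/h; apply: filterS => n; rewrite rnormE er lecR.
Qed.

End RnormLimits.

Section Spectral.
Context {R : realType} {H : completeNormedModType R[i]}.
Variable ip : {dot H for conjC}.
Hypothesis Hip : norm_from_dot ip.
Variable E : set (borelC R) -> {linear H -> H}.
Hypothesis Epvm : projection_valued_measure ip E.
Implicit Types (u v : H) (D S : set (borelC R)).

Lemma pvm_idem D u : measurable D -> E D (E D u) = E D u.
Proof. by move=> mD; case: (pvm_proj Epvm mD). Qed.

Lemma pvm_adj D u v : measurable D -> ip (E D u) v = ip u (E D v).
Proof. by move=> mD; case: (pvm_proj Epvm mD). Qed.

Lemma spectral_measE D u : measurable D ->
  spectral_meas ip E u D = rnorm (E D u) ^+ 2.
Proof.
move=> mD; rewrite /spectral_meas -[in LHS](pvm_idem u mD) (pvm_adj _ _ mD).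
by rewrite (ip_rnorm Hip).
Qed.

Lemma rnorm_pvm_le D u : measurable D -> rnorm (E D u) <= rnorm u.
Proof.
move=> mD; have [->|u0] := eqVneq (rnorm (E D u)) 0; first exact: rnorm_ge0.
have p : 0 < rnorm (E D u) by rewrite lt_def u0 rnorm_ge0.
rewrite -(ler_pM2l p) -expr2 -spectral_measE// /spectral_meas.
by rewrite (le_trans (ler_norm _))// (le_trans (ger_Re_rnorm _))// rnorm_ip_le.
Qed.

(** Sigma-additivity along the constant sequence [set0] makes a series with constant terms converge,
    so its term is zero. *)
Lemma pvm0 u : E set0 u = 0.
Proof.
have h := @pvm_sigma_additive _ _ _ _ Epvm (fun=> set0) (fun=> measurable0)
  (@trivIset_set0 _ _ _) u.
have lim0 : (fun=> E set0 u) @ \oo --> (0 : H) := cvg_series_cvg_0 (cvgP _ h).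
exact: (cvg_unique _ (cvg_cst (E set0 u)) lim0).
Qed.

Lemma pvm_disj D1 D2 u : measurable D1 -> measurable D2 -> D1 `&` D2 = set0 ->
  E D1 (E D2 u) = 0.
Proof. by move=> m1 m2 d; rewrite -(pvmI Epvm)// d pvm0. Qed.

Lemma pvm_sub D1 D2 u : measurable D1 -> measurable D2 -> D1 `<=` D2 ->
  E D1 (E D2 u) = E D1 u.
Proof. by move=> m1 m2 d; rewrite -(pvmI Epvm)// setIidl. Qed.

Lemma pvm_sup D1 D2 u : measurable D1 -> measurable D2 -> D1 `<=` D2 ->
  E D2 (E D1 u) = E D1 u.
Proof. by move=> m1 m2 d; rewrite -(pvmI Epvm)// setIidr. Qed.

Lemma pvm_comm D1 D2 u : measurable D1 -> measurable D2 ->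
  E D1 (E D2 u) = E D2 (E D1 u).
Proof. by move=> m1 m2; rewrite -!(pvmI Epvm)// setIC. Qed.

Lemma pvm_bigcup_fin (F : nat -> set (borelC R)) (N : nat) u :
  (forall n, measurable (F n)) -> trivIset setT F ->
  (forall n, (N <= n)%N -> F n = set0) ->
  E (\bigcup_n F n) u = \sum_(n < N) E (F n) u.
Proof.
move=> mF tF F0; have h := @pvm_sigma_additive _ _ _ _ Epvm F mF tF u.
apply: (cvg_unique _ h) => //.
apply: cvg_near_cst.
exists N => // n /= Nn; rewrite /series /= (big_cat_nat (leq0n N) Nn)/=.
rewrite big_mkord [X in _ + X]big_nat [X in _ + X]big1 ?addr0// => i /andP[Ni _].
by rewrite F0// pvm0.
Qed.

Lemma pvm_sum_orthogonal (F : nat -> set (borelC R)) (N : nat) (g : 'I_N -> H) :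
  (forall n, measurable (F n)) -> trivIset setT F ->
  rnorm (\sum_(n < N) E (F n) (g n)) ^+ 2 = \sum_(n < N) rnorm (E (F n) (g n)) ^+ 2.
Proof.
move=> mF tF; apply: (rnorm_sum_orthogonal Hip) => i j ij.
rewrite pvm_adj// pvm_disj ?ip0r//.
by move/trivIsetP : tF; apply.
Qed.

(** The sum [s] of the pieces satisfies Re <s, u> = |s|^2, so that |s - u|^2 = |u|^2 - |s|^2. *)
Lemma pvm_bessel (F : nat -> set (borelC R)) (N : nat) u :
  (forall n, measurable (F n)) -> trivIset setT F ->
  \sum_(n < N) rnorm (E (F n) u) ^+ 2 <= rnorm u ^+ 2.
Proof.
move=> mF tF; rewrite -(pvm_sum_orthogonal (fun=> u))//.
set s := \sum_(n < N) _.
have e : complex.Re (ip s u) = rnorm s ^+ 2.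
  rewrite /s (pvm_sum_orthogonal (fun=> u))// ip_suml Re_sum.
  by apply: eq_bigr => i _; rewrite -spectral_measE.
have := sqr_ge0 (rnorm (s - u)); rewrite (rnorm_sqrB Hip) e.
lra.
Qed.

Lemma spectral_measure_exists u :
  exists mu : {measure set (borelC R) -> \bar R}, forall D, measurable D ->
    mu D = (spectral_meas ip E u D)%:E.
Proof.
(* [E] is arbitrary off the Borel sets, whereas a measure structure asks for nonnegative values on
   every set; 0 is a harmless value there. *)
pose m D : \bar R := if `[< measurable D >] then (spectral_meas ip E u D)%:E else 0%E.
have mE D : measurable D -> m D = (spectral_meas ip E u D)%:E.
  by move=> mD; rewrite /m asboolT.
have m0 : m set0 = 0%E.
  by rewrite mE// spectral_measE// pvm0 rnorm0 expr0n.
have m_ge0 D : (0 <= m D)%E.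
  rewrite /m; case: ifPn => // /asboolP mD.
  by rewrite lee_fin spectral_measE// sqr_ge0.
have m_sigma : semi_sigma_additive m.
  move=> F mF tF mUF; rewrite mE//.
  have h := @pvm_sigma_additive _ _ _ _ Epvm F mF tF u.
  have -> : (fun n => \sum_(0 <= i < n) m (F i))%E =
     (fun n => (complex.Re (ip (series (fun n => E (F n) u) n) u))%:E).
    apply/funext => n; rewrite /series /= ip_suml Re_sum -sumEFin.
    by apply: eq_bigr => i _; rewrite mE.
  apply: cvg_EFin; first by apply: nearW.
  apply/cvgrPdist_le => e e0 /=.
  pose d := e / (rnorm u + 1).
  have up : 0 < rnorm u + 1 by rewrite ltr_wpDl ?rnorm_ge0.
  have d0 : 0 < d by rewrite divr_gt0.
  move/cvg_rnormP : h => /(_ d d0); apply: filterS => n hn /=.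
  rewrite /spectral_meas -ReN -ReD -ipNl -ipDl (le_trans (ger_Re_rnorm _))//.
  rewrite (le_trans (rnorm_ip_le Hip _ _))//.
  rewrite (le_trans (ler_wpM2r (rnorm_ge0 u) hn))//.
  by rewrite /d mulrAC ler_pdivrMr//; have := rnorm_ge0 u; nra.
pose M := isMeasure.Build _ _ _ m m0 m_ge0 m_sigma.
pose mu : {measure set (borelC R) -> \bar R} := HB.pack m M.
by exists mu.
Qed.

End Spectral.

(** * The operator and its spectral measure *)

Section SetFunctionIntegral.
Import HBNNSimple.

(* [eq_measure_integral] does not apply to the spectral distributions, which are
   only known to be additive on Borel sets and hence are mere set functions. *)
Lemma eq_setfun_integral d (T : measurableType d) (R : realType) (D : set T)
    (m1 m2 : set T -> \bar R) (f : T -> \bar R) :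
  (forall A, measurable A -> m1 A = m2 A) ->
  (\int[m1]_(x in D) f x = \int[m2]_(x in D) f x)%E.
Proof.
move=> m12.
have e (h : {nnsfun T >-> R}) : sintegral m1 h = sintegral m2 h.
  by apply: eq_fsbigr => r _; rewrite m12//; exact: measurable_funPTI.
by rewrite /integral; congr (ereal_sup _ - ereal_sup _)%E;
  apply: eq_imagel => h _; exact: e.
Qed.

End SetFunctionIntegral.

(** * Quadratic forms given by integrals against the spectral distributions *)

Section QuadraticForms.
Context {R : realType} {H : completeNormedModType R[i]}.
Variable ip : {dot H for conjC}.
Hypothesis Hip : norm_from_dot ip.
Variable E : set (borelC R) -> {linear H -> H}.
Hypothesis Epvm : projection_valued_measure ip E.
Implicit Types (u v : H) (D S : set (borelC R)).
Variables (f : borelC R -> R) (Q : H -> R).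
Hypothesis mf : measurable_fun [set: borelC R] f.
Hypothesis QE : forall u,
  ((Q u)%:E = \int[fun D => (spectral_meas ip E u D)%:E]_(z in [set: borelC R]) (f z)%:E)%E.

(** The mass outside [D] is |E(~D) E(D) u|^2 = 0, so the integral localizes to [D]. *)
Lemma qform_support u D (mu : {measure set (borelC R) -> \bar R}) :
  (forall S, measurable S -> mu S = (spectral_meas ip E u S)%:E) ->
  measurable D -> E D u = u ->
  mu D = (rnorm u ^+ 2)%:E /\ ((Q u)%:E = \int[mu]_(z in D) (f z)%:E)%E.
Proof.
move=> muE mD Du; split; first by rewrite muE// (spectral_measE Hip Epvm)// Du.
have -> : ((Q u)%:E = \int[mu]_(z in [set: borelC R]) (f z)%:E)%E.
  by rewrite QE; apply: eq_setfun_integral => S mS; rewrite muE.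
apply: integral_support => //.
rewrite muE; last exact: measurableC.
rewrite (spectral_measE Hip Epvm); last exact: measurableC.
rewrite -Du (pvm_disj Epvm) ?rnorm0 ?expr0n//; first exact: measurableC.
by rewrite setICl.
Qed.

Lemma bounded_integrable D (mu : {measure set (borelC R) -> \bar R}) (M : R) :
  measurable D -> (mu D < +oo)%E -> (forall z, D z -> `|f z| <= M) ->
  mu.-integrable D (EFin \o f).
Proof.
move=> mD Dfin fM; apply: measurable_bounded_integrable => //.
  exact: measurable_funS mf.
exists M; split; first exact: num_real.
by move=> N MN z Dz /=; apply: le_trans (fM z Dz) _; exact: ltW.
Qed.

Lemma qform_bound u D (c s : R) : measurable D -> E D u = u ->
  (forall z, D z -> `|f z - c| <= s) ->
  `|Q u - c * rnorm u ^+ 2| <= s * rnorm u ^+ 2.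
Proof.
move=> mD Du fs.
have [mu muE] := spectral_measure_exists Hip Epvm u.
have [muD Qu] := qform_support muE mD Du.
have Dfin : (mu D < +oo)%E by rewrite muD ltry.
have fI : mu.-integrable D (EFin \o f).
  apply: (@bounded_integrable _ _ (`|c| + s)) => // z Dz.
  by rewrite -[X in `|X|](subrK c) (le_trans (ler_normD _ _))// addrC lerD2l fs.
have cI (a : R) : mu.-integrable D (EFin \o cst a).
  apply: measurable_bounded_integrable => //.
  by exists `|a|; split; [exact: num_real|move=> N aN z _ /=; exact: ltW].
have cint (a : R) : (\int[mu]_(z in D) (a%:E) = (a * rnorm u ^+ 2)%:E)%E.
  by rewrite integral_cst// muD.
have up : Q u <= (c + s) * rnorm u ^+ 2.
  rewrite -lee_fin Qu -cint; apply: le_integral => //; first exact: cI.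
  move=> z; rewrite inE => Dz.
  by rewrite lee_fin -lerBlDl (le_trans (ler_norm _))// fs.
have lo : (c - s) * rnorm u ^+ 2 <= Q u.
  rewrite -lee_fin Qu -cint; apply: le_integral => //; first exact: cI.
  move=> z; rewrite inE => Dz.
  by rewrite lee_fin lerBlDr -lerBlDl (le_trans (ler_norm _))// distrC fs.
by rewrite ler_norml; apply/andP; split; lra.
Qed.

Lemma qform_add u v B (M : R) : measurable B -> (forall w, E B w = w) ->
  (forall z, B z -> `|f z| <= M) ->
  (forall D, measurable D ->
     spectral_meas ip E (u + v) D = spectral_meas ip E u D + spectral_meas ip E v D) ->
  Q (u + v) = Q u + Q v.
Proof.
move=> mB EB fM add.
have [mu muE] := spectral_measure_exists Hip Epvm u.
have [mv mvE] := spectral_measure_exists Hip Epvm v.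
have mE D : measurable D ->
    measure_add mu mv D = (spectral_meas ip E (u + v) D)%:E.
  by move=> mD; rewrite measure_addE muE// mvE// add.
have [muB Qu] := qform_support muE mB (EB u).
have [mvB Qv] := qform_support mvE mB (EB v).
have [_ Quv] := qform_support mE mB (EB (u + v)).
suff : ((Q (u + v))%:E = (Q u + Q v)%:E)%E by case.
rewrite Quv EFinD Qu Qv integral_measure_add//.
- by apply: (@bounded_integrable _ _ M) => //; rewrite muB ltry.
- by apply: (@bounded_integrable _ _ M) => //; rewrite mvB ltry.
Qed.

End QuadraticForms.

(** * Commutation of [A] with its spectral projections, and local norm bounds *)

Section SpectralOperator.
Context {R : realType} {H : completeNormedModType R[i]}.
Variable ip : {dot H for conjC}.
Hypothesis Hip : norm_from_dot ip.
Variables (A : {linear H -> H}) (E : set (borelC R) -> {linear H -> H}).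
Hypothesis AE : spectral_measure_of ip A E.
Implicit Types (u v : H) (D S : set (borelC R)).

Let Epvm := spm_pvm AE.

Let QRe u : ((complex.Re (ip (A u) u))%:E =
  \int[fun D => (spectral_meas ip E u D)%:E]_(z in [set: borelC R]) (complex.Re (z : R[i]))%:E)%E.
Proof. by have [] := spm_integral AE u. Qed.

Let QIm u : ((complex.Im (ip (A u) u))%:E =
  \int[fun D => (spectral_meas ip E u D)%:E]_(z in [set: borelC R]) (complex.Im (z : R[i]))%:E)%E.
Proof. by have [] := spm_integral AE u. Qed.

(** The cross terms vanish, so the distribution of [u + v] is the sum of those of [u] and [v]; the
    bounded support of [E] makes real and imaginary parts integrable. *)
Lemma spectral_form_add u v :
  (forall D, measurable D -> ip (E D u) v = 0) ->
  ip (A (u + v)) (u + v) = ip (A u) u + ip (A v) v.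
Proof.
move=> o; have [r Er] := spm_bounded AE; rewrite cdisc0E in Er.
have add D : measurable D ->
    spectral_meas ip E (u + v) D = spectral_meas ip E u D + spectral_meas ip E v D.
  move=> mD.
  have e : ip (E D v) u = 0 by rewrite (pvm_adj Epvm)// ipC (o D mD) conjc0.
  by rewrite /spectral_meas linD !ipDl !ipDr !ReD e (o D mD) /= addr0 add0r.
have disc_le (z : R[i]) : cdisc 0 r z -> rnorm z <= r.
  by rewrite /cdisc /= sub0r rnormN.
apply/eqP; rewrite eq_complex ReD ImD; apply/andP; split; apply/eqP.
  apply: (@qform_add _ _ _ Hip _ Epvm _ _ measurable_Re QRe u v (cdisc 0 r) r) => //.
    exact: measurable_cdisc.
  by move=> z /disc_le; apply: le_trans; exact: ger_Re_rnorm.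
apply: (@qform_add _ _ _ Hip _ Epvm _ _ measurable_Im QIm u v (cdisc 0 r) r) => //.
  exact: measurable_cdisc.
by move=> z /disc_le; apply: le_trans; exact: ger_Im_rnorm.
Qed.

(** Polarization: additivity of the form at [u] and [v] says that the two pairings have sum 0, and
    at [u] and i [v] that they have difference 0. *)
Lemma spectral_form_ortho u v : (forall D, measurable D -> ip (E D u) v = 0) ->
  ip (A u) v = 0 /\ ip (A v) u = 0.
Proof.
move=> o.
have e1 : ip (A u) v + ip (A v) u = 0.
  have := spectral_form_add o; rewrite linD !ipDl !ipDr.
  move: (ip (A u) u) (ip (A u) v) (ip (A v) u) (ip (A v) v) => a b c d h.
  by apply: (addrI (a + d)); rewrite addr0 -[RHS]h; ring.
have e2 : ip (A u) v - ip (A v) u = 0.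
  have o' D : measurable D -> ip (E D u) ('i%C *: v) = 0.
    by move=> mD; rewrite ipZr o// mulr0.
  have := spectral_form_add o'; rewrite linD linZ !ipDl !ipDr !ipZl !ipZr.
  have -> : conjc 'i%C = - 'i%C :> R[i] by simpc.
  move: (ip (A u) u) (ip (A u) v) (ip (A v) u) (ip (A v) v) => a b c d h.
  have i0 : - 'i%C != 0 :> R[i] by rewrite oppr_eq0 eq_complex /= oner_eq0 andbF.
  apply: (mulfI i0); rewrite mulr0.
  by apply: (addrI (a + 'i%C * (- 'i%C * d))); rewrite addr0 -[RHS]h; ring.
have e3 : ip (A u) v = 0.
  have := congr2 +%R e1 e2; rewrite addr0 addrACA subrr addr0 -mulr2n => /eqP.
  by rewrite mulrn_eq0 => /eqP.
by split=> //; move: e1; rewrite e3 add0r.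
Qed.

(** Vectors of the form [E D v] and [w - E D w] are spectrally orthogonal, so both off-diagonal
    blocks of [A] relative to [E D] vanish. *)
Lemma spectral_commute D u : measurable D -> A (E D u) = E D (A u).
Proof.
move=> mD.
have ortho v w : ip (A (E D v)) (w - E D w) = 0 /\ ip (A (w - E D w)) (E D v) = 0.
  apply: spectral_form_ortho => S mS.
  rewrite ipDr ipNr -(pvm_adj Epvm _ _ mD) (pvm_comm Epvm)// (pvm_idem Epvm)//.
  by rewrite (pvm_comm Epvm)// subrr.
have inj v : (forall w, ip v w = 0) -> v = 0.
  by move=> /(_ v) /eqP; rewrite dnorm_eq0 => /eqP.
have e1 : A (E D u) = E D (A (E D u)).
  apply/eqP; rewrite -subr_eq0; apply/eqP; apply: inj => w.
  have [+ _] := ortho u w.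
  by rewrite ipDr ipNr -(pvm_adj Epvm _ _ mD) -ipNl -ipDl.
have e2 : E D (A (u - E D u)) = 0.
  apply: inj => w; rewrite (pvm_adj Epvm)//.
  by have [] := ortho w u.
by rewrite e1; apply/eqP; rewrite eq_sym -subr_eq0 -!linB e2.
Qed.

Lemma spectral_form_bound u D (l : R[i]) (s : R) : measurable D -> E D u = u ->
  (forall z : R[i], D z -> rnorm (z - l) <= s) ->
  rnorm (ip (A u - l *: u) u) <= 2 * s * rnorm u ^+ 2.
Proof.
move=> mD Du Ds.
have hR : `|complex.Re (ip (A u) u) - complex.Re l * rnorm u ^+ 2| <= s * rnorm u ^+ 2.
  apply: (qform_bound Hip Epvm measurable_Re QRe mD Du) => z Dz.
  by rewrite -ReN -ReD (le_trans (ger_Re_rnorm _))// Ds.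
have hI : `|complex.Im (ip (A u) u) - complex.Im l * rnorm u ^+ 2| <= s * rnorm u ^+ 2.
  apply: (qform_bound Hip Epvm measurable_Im QIm mD Du) => z Dz.
  by rewrite -ImN -ImD (le_trans (ger_Im_rnorm _))// Ds.
rewrite ipDl ipNl ipZl (ip_rnorm Hip) (mulrC l).
apply: (le_trans (rnorm_le_Re_Im _)).
rewrite ReD ImD ReN ImN Re_mulr Im_mulr ![rnorm u ^+ 2 * _]mulrC.
by lra.
Qed.

(* The numerical range of a bounded operator controls its norm up to a factor
   2, by polarization. *)
Lemma spectral_local_bound u D (l : R[i]) (s : R) :
  measurable D -> E D u = u -> 0 < s ->
  (forall z : R[i], D z -> rnorm (z - l) <= s) ->
  rnorm (A u - l *: u) <= 4 * s * rnorm u.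
Proof.
move=> mD Du s0 Ds.
pose T w := A w - l *: w.
have TD v w : T (v + w) = T v + T w.
  by rewrite /T linD scalerDr opprD addrACA.
have TN w : T (- w) = - T w by rewrite /T linN scalerN opprD.
have TZ a w : T (a *: w) = a *: T w.
  by rewrite /T linZ scalerBr !scalerA mulrC.
have TE w : E D w = w -> E D (T w) = T w.
  by move=> Dw; rewrite /T linB linZ -spectral_commute// Dw.
have form w : E D w = w -> rnorm (ip (T w) w) <= 2 * s * rnorm w ^+ 2.
  by move=> Dw; apply: (spectral_form_bound mD).
have sym v : E D v = v -> rnorm (ip (T u) v + ip (T v) u) <=
    2 * s * (rnorm u ^+ 2 + rnorm v ^+ 2).
  move=> Dv.
  have e : 2%:R * (ip (T u) v + ip (T v) u) =
      ip (T (u + v)) (u + v) - ip (T (u - v)) (u - v).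
    by rewrite !TD TN !(ipDl, ipDr, ipNl, ipNr); ring.
  have fp : rnorm (ip (T (u + v)) (u + v)) <= 2 * s * rnorm (u + v) ^+ 2.
    by apply: form; rewrite linD Du Dv.
  have fm : rnorm (ip (T (u - v)) (u - v)) <= 2 * s * rnorm (u - v) ^+ 2.
    by apply: form; rewrite linB Du Dv.
  have := rnormB (ip (T (u + v)) (u + v)) (ip (T (u - v)) (u - v)).
  rewrite -e rnormM rnorm_nat; move: fp fm.
  rewrite (rnorm_sqrD Hip) (rnorm_sqrB Hip).
  lra.
have polar v : E D v = v ->
    rnorm (ip (T u) v) <= 2 * s * (rnorm u ^+ 2 + rnorm v ^+ 2).
  move=> Dv.
  have h1 := sym v Dv.
  (* Replacing [v] by i [v] in [sym] turns the sum into a difference, up to a unimodular factor. *)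
  have : rnorm (ip (T u) v - ip (T v) u) <= 2 * s * (rnorm u ^+ 2 + rnorm v ^+ 2).
    have := sym ('i%C *: v); rewrite linZ Dv => /(_ erefl).
    rewrite TZ ipZl ipZr rnormZ rnormi mul1r.
    have -> : conjc 'i%C = - 'i%C :> R[i] by simpc.
    by rewrite mulNr addrC -mulrBr rnormM rnormi mul1r rnorm_distC.
  have := rnormD (ip (T u) v + ip (T v) u) (ip (T u) v - ip (T v) u).
  have -> : ip (T u) v + ip (T v) u + (ip (T u) v - ip (T v) u) = 2%:R * ip (T u) v.
    by ring.
  rewrite rnormM rnorm_nat.
  lra.
(* This multiple of [T u] balances the two sides: after multiplication by 8 s the bound reads 2 t^2
   <= (4 s r)^2 + t^2, and one t^2 is absorbed. *)
have := polar ((4 * s)^-1%:C *: T u).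
rewrite linZ TE// => /(_ erefl).
rewrite ipZr conjc_real (ip_rnorm Hip) rnormZ rnormM !rnorm_real.
rewrite !ger0_norm ?sqr_ge0 ?invr_ge0 ?mulr_ge0 ?(ltW s0)//.
have -> : A u - l *: u = T u by [].
set t := rnorm (T u); set r := rnorm u => h.
rewrite -(@ler_pXn2r _ 2) ?nnegrE ?mulr_ge0 ?rnorm_ge0 ?(ltW s0)//.
have : (8 * s) * ((4 * s)^-1 * t ^+ 2) <=
    (8 * s) * (2 * s * (r ^+ 2 + ((4 * s)^-1 * t) ^+ 2)).
  by rewrite ler_wpM2l// mulr_ge0// ltW.
have -> : 8 * s * ((4 * s)^-1 * t ^+ 2) = 2 * t ^+ 2 by field; rewrite gt_eqF.
have -> : 8 * s * (2 * s * (r ^+ 2 + ((4 * s)^-1 * t) ^+ 2)) =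
  (4 * s * r) ^+ 2 + t ^+ 2 by field; rewrite gt_eqF.
lra.
Qed.

End SpectralOperator.

(** * Fine partitions of the closed disc *)

Section Partition.
Context {R : realType}.

Lemma grid_approx (k : nat) (x : R) : (0 < k)%N -> `|x| <= 1 ->
  exists2 a : nat, (a < (2 * k).+1)%N & `|x - (a%:R / k%:R - 1)| <= k%:R^-1.
Proof.
move=> k0 x1; have kp : 0 < k%:R :> R by rewrite ltr0n.
have [xl xu] : -1 <= x /\ x <= 1 by move: x1; rewrite ler_norml => /andP.
have y0 : 0 <= (x + 1) * k%:R by apply: mulr_ge0; [lra|exact: ltW].
have /andP[al au] := truncn_itv y0.
set a := Num.truncn _ in al au; exists a.
  rewrite ltnS -(ler_nat R) natrM (le_trans al)// ler_pM2r//; lra.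
have al' : a%:R / k%:R <= x + 1 by rewrite ler_pdivrMr.
have au' : x + 1 < a%:R / k%:R + k%:R^-1.
  have : x + 1 < a.+1%:R / k%:R by rewrite ltr_pdivlMr.
  by rewrite -natr1 mulrDl mul1r.
by rewrite ler_norml; apply/andP; split; lra.
Qed.

Lemma closed_unit_disc_cover (e : R) : 0 < e ->
  exists (N : nat) (c : nat -> R[i]), forall w : R[i], closed_unit_disc w ->
    exists2 n, (n < N)%N & rnorm (c n - w) < e.
Proof.
move=> e0; have [k0 hk] : exists k, 2 / e < k%:R.
  by exists (Num.truncn (2 / e)).+1; exact: truncnS_gt.
have kp : 0 < k0%:R :> R by apply: lt_trans hk; rewrite divr_gt0.
have k_gt0 : (0 < k0)%N by rewrite -(ltr0n R).
pose m := (2 * k0).+1.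
pose g a : R := a%:R / k0%:R - 1.
(* The grid node with coordinates [a], [b] has index [a * m + b]. *)
exists (m * m)%N, (fun n => g (n %/ m)%N +i* g (n %% m)%N) => w w1.
have [a am ha] := grid_approx k_gt0 (le_trans (ger_Re_rnorm w) w1).
have [b bm hb] := grid_approx k_gt0 (le_trans (ger_Im_rnorm w) w1).
exists (a * m + b)%N.
  by rewrite -ltn_divLR// divnMDl// divn_small// addn0.
rewrite divnMDl// divn_small// addn0 modnMDl modn_small// rnorm_distC.
apply: (le_lt_trans (rnorm_le_Re_Im _)); rewrite ReD ImD ReN ImN /=.
apply: (le_lt_trans (lerD ha hb)).
have : k0%:R^-1 < e / 2.
  by rewrite -[e / 2]invrK ltf_pV2 ?posrE ?invr_gt0 ?divr_gt0// invf_div.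
lra.
Qed.

Lemma closed_unit_disc_partition (e : R) : 0 < e ->
  exists (N : nat) (F : nat -> set (borelC R)) (z : nat -> R[i]),
    [/\ forall n, measurable (F n), trivIset setT F,
        forall n, (N <= n)%N -> F n = set0,
        \bigcup_n F n = closed_unit_disc &
        forall n, rnorm (z n) <= 1 /\ forall w : R[i], F n w -> rnorm (w - z n) <= e].
Proof.
move=> e0; have e20 : 0 < e / 2 by rewrite divr_gt0.
have [N [c cov]] := closed_unit_disc_cover e20.
pose G n : set (borelC R) :=
  if (n < N)%N then closed_unit_disc `&` disc (c n) (e / 2) else set0.
have mG n : measurable (G n).
  rewrite /G; case: ifP => // _.
  by apply: measurableI; [exact: measurable_closed_unit_disc|exact: measurable_disc].
have GE n w : seqDU G n w -> closed_unit_disc w /\ rnorm (c n - w) < e / 2.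
  by case=> + _; rewrite /G; case: ifP => // _ [].
(* The centers [c n] may lie outside the disc, so each sample point is taken in its own cell, of
   diameter at most [e]; an empty cell receives 0. *)
exists N, (seqDU G), (fun n => xget 0 (seqDU G n)); split.
- exact: seqDU_measurable.
- exact: trivIset_seqDU.
- move=> n Nn; rewrite -subset0 => w [+ _].
  by rewrite /G ltnNge Nn.
- rewrite -seqDU_bigcup_eq; apply/seteqP; split => w.
    by case=> n _; rewrite /G; case: ifP => // _ [].
  move=> w1; have [n nN cw] := cov _ w1.
  by exists n => //; rewrite /G nN.
move=> n; split.
  by case: xgetP => [w _ /GE []|_]//; rewrite rnorm0.
move=> w Fw; have [_ cw] := GE _ _ Fw.
case: xgetP => [w' _ /GE [_ cw']|/(_ w)]//.
have -> : w - w' = (c n - w') - (c n - w) by ring.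
apply: (le_trans (rnormB _ _)).
lra.
Qed.

End Partition.

(** * The operator on the spectral subspace of the closed disc *)

Section BoundedLimits.
Context {R : realType} {H : completeNormedModType R[i]}.

Lemma rnorm_series_cvg (y : nat -> H) :
  cvgn (series (fun n => rnorm (y n))) -> cvgn (series y).
Proof.
move=> /cauchy_cvgP/cauchy_seriesP h.
apply/cauchy_cvgP/cauchy_seriesP => e e0.
have er : e = (complex.Re e)%:C by rewrite RRe_real// realE ltW.
have : 0 < complex.Re e by rewrite -ltcR -er.
move/h; apply: filterS => n /=.
rewrite ger0_norm ?sumr_ge0// => [lte|i _]; last exact: rnorm_ge0.
by rewrite rnormE er ltcR (le_lt_trans _ lte)// rnorm_sum.
Qed.

Lemma bounded_linear_cvg (F : {linear H -> H}) (M : R) (y : nat -> H) (l : H) :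
  (forall u, rnorm (F u) <= M * rnorm u) -> y @ \oo --> l ->
  (fun n => F (y n)) @ \oo --> F l.
Proof.
move=> FM /cvg_rnormP yl; apply/cvg_rnormP => e e0.
have M0 : 0 < `|M| + 1 by rewrite ltr_wpDl.
have d0 : 0 < e / (`|M| + 1) by rewrite divr_gt0.
move: (yl _ d0); apply: filterS => n hn.
rewrite -linB (le_trans (FM _))//.
have le1 : M * rnorm (l - y n) <= (`|M| + 1) * rnorm (l - y n).
  by rewrite ler_wpM2r ?rnorm_ge0// (le_trans (ler_norm _))// lerDl.
by rewrite (le_trans le1)// mulrC -ler_pdivlMr.
Qed.

End BoundedLimits.

Section SpectralSubspace.
Context {R : realType} {H : completeNormedModType R[i]}.
Variable ip : {dot H for conjC}.
Hypothesis Hip : norm_from_dot ip.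
Variables (A : {linear H -> H}) (E : set (borelC R) -> {linear H -> H}).
Hypothesis AE : spectral_measure_of ip A E.
Implicit Types (u v : H) (D S : set (borelC R)).

Let Epvm := spm_pvm AE.
Let mDisc := @measurable_closed_unit_disc R.

Lemma spectral_rangeP D u : measurable D -> range (E D) u <-> E D u = u.
Proof.
move=> mD; split=> [[v _ <-]|Du]; first exact: (pvm_idem Epvm).
by exists u.
Qed.

Lemma spectral_decomposition (F : nat -> set (borelC R)) (N : nat) u :
  (forall n, measurable (F n)) -> trivIset setT F ->
  (forall n, (N <= n)%N -> F n = set0) ->
  \bigcup_n F n = closed_unit_disc -> E closed_unit_disc u = u ->
  u = \sum_(n < N) E (F n) u.
Proof.
by move=> mF tF F0 UF Du; rewrite -(pvm_bigcup_fin Epvm)// UF.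
Qed.

(** On a cell of a partition of mesh [e], [A] is within 4 [e] of a scalar of modulus at most 1; the
    cells are orthogonal and preserved by [A], so the bounds add up in squares, and [e] tends to
    0. *)
Lemma spectral_contraction u :
  E closed_unit_disc u = u -> rnorm (A u) <= rnorm u.
Proof.
move=> Du.
have step e : 0 < e -> rnorm (A u) <= (1 + 4 * e) * rnorm u.
  move=> e0; have [N [F [z [mF tF F0 UF zF]]]] := closed_unit_disc_partition e0.
  have uE := spectral_decomposition mF tF F0 UF Du.
  rewrite -(@ler_pXn2r _ 2) ?nnegrE ?mulr_ge0 ?rnorm_ge0 ?addr_ge0 ?mulr_ge0 ?(ltW e0)//.
  have AuE : A u = \sum_(n < N) E (F n) (A (E (F n) u)).
    rewrite {1}uE lin_sum; apply: eq_bigr => n _.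
    by rewrite -(spectral_commute Hip AE)// (pvm_idem Epvm).
  rewrite {1}AuE (pvm_sum_orthogonal Hip Epvm (fun n => A (E (F n) u)))//.
  rewrite exprMn [in leRHS]uE (pvm_sum_orthogonal Hip Epvm (fun=> u))// big_distrr /=.
  apply: ler_sum => n _; rewrite -exprMn -(spectral_commute Hip AE)// (pvm_idem Epvm)//.
  rewrite ler_pXn2r ?nnegrE ?mulr_ge0 ?rnorm_ge0 ?addr_ge0 ?mulr_ge0 ?(ltW e0)//.
  have [z1 Fz] := zF n.
  have h := spectral_local_bound Hip AE (mF n) (pvm_idem Epvm u (mF n)) e0 Fz.
  rewrite -[A _](subrK (z n *: E (F n) u)) (le_trans (rnormD _ _))//.
  have hz : rnorm (z n *: E (F n) u) <= rnorm (E (F n) u).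
    by rewrite rnormZ ler_piMl ?rnorm_ge0.
  by rewrite mulrDl mul1r addrC lerD.
apply/ler_addgt0Pr => e e0.
have up : 0 < 4 * (rnorm u + 1) by rewrite mulr_gt0// ltr_wpDl ?rnorm_ge0.
have := step (e / (4 * (rnorm u + 1))); rewrite divr_gt0// => /(_ isT) h.
apply: (le_trans h); rewrite mulrDl mul1r lerD2l.
rewrite mulrA mulrAC ler_pdivrMr//; have := rnorm_ge0 u; nra.
Qed.

Lemma spectral_iter D u k : measurable D -> E D u = u -> E D (iter k A u) = iter k A u.
Proof.
by move=> mD Du; elim: k => //= k IH; rewrite -(spectral_commute Hip AE)// IH.
Qed.

Lemma spectral_iter_contraction u k :
  E closed_unit_disc u = u -> rnorm (iter k A u) <= rnorm u.
Proof.
move=> Du; elim: k => //= k IH; apply: le_trans IH.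
by apply: spectral_contraction; apply: spectral_iter.
Qed.

Lemma iter_linZ k (a : R[i]) u : iter k A (a *: u) = a *: iter k A u.
Proof. by elim: k => //= k ->; rewrite linZ. Qed.

Lemma neumann_partial (l : R[i]) u n : l != 0 ->
  A (\sum_(k < n) - (l ^- k.+1 *: iter k A u)) - l *: (\sum_(k < n) - (l ^- k.+1 *: iter k A u)) =
    u - l ^- n *: iter n A u.
Proof.
move=> l0; elim: n => [|n IH].
  by rewrite !big_ord0 lin0 scaler0 subrr expr0 invr1 scale1r subrr.
rewrite !big_ord_recr /= linD scalerDr opprD addrACA IH (linN A) (linZ A).
rewrite scalerN opprK scalerA exprS invfM mulrA mulfV// mul1r.
by rewrite addrACA addNr addr0.
Qed.

(** A contraction has no eigenvalue of modulus above 1, which gives injectivity; the Neumann series,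
    dominated by a geometric one, gives surjectivity. *)
Lemma spectral_resolvent_bij (l : R[i]) : bounded_operator A -> 1 < rnorm l ->
  set_bij (range (E closed_unit_disc)) (range (E closed_unit_disc))
    (fun u => A u - l *: u).
Proof.
move=> [M AM] l1.
have l0 : l != 0 by rewrite -rnorm_eq0 gt_eqF// (lt_trans _ l1).
split.
- move=> u /spectral_rangeP => /(_ mDisc) Du; apply/spectral_rangeP => //.
  by rewrite linB linZ -(spectral_commute Hip AE)// Du.
- move=> u v; rewrite !inE => /spectral_rangeP => /(_ mDisc) Du.
  move=> /spectral_rangeP => /(_ mDisc) Dv e.
  apply/eqP; rewrite -subr_eq0 -rnorm_eq0.
  have Auv : A (u - v) = l *: (u - v).
    have /eqP := e; rewrite -subr_eq0 => /eqP e0.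
    apply/eqP; rewrite -subr_eq0; apply/eqP; rewrite -[RHS]e0 linB scalerBr !opprB.
    by rewrite addrACA [RHS]addrACA; congr (_ + _); exact: addrC.
  have := @spectral_contraction (u - v); rewrite linB Du Dv Auv => /(_ erefl).
  rewrite rnormZ => h; apply/eqP/le_anti; rewrite rnorm_ge0 andbT.
  have := rnorm_ge0 (u - v); nra.
move=> u /spectral_rangeP => /(_ mDisc) Du.
pose y k := - (l ^- k.+1 *: iter k A u).
have r1 : `|(rnorm l)^-1| < 1.
  by rewrite ger0_norm ?invr_ge0 ?rnorm_ge0// invf_lt1// (lt_trans _ l1).
have cvy : cvgn (series y).
  apply: rnorm_series_cvg.
  apply: (@series_le_cvg _ _ (geometric (rnorm u / rnorm l) (rnorm l)^-1)); last 1 first.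
  - exact: is_cvg_geometric_series.
  - by move=> n; exact: rnorm_ge0.
  - by move=> n; rewrite /geometric /= mulr_ge0 ?exprn_ge0 ?divr_ge0 ?invr_ge0 ?rnorm_ge0.
  - move=> n; rewrite /y rnormN rnormZ rnormV rnormX /geometric /=.
  rewrite exprS invfM exprVn mulrC mulrA ler_wpM2r ?invr_ge0 ?exprn_ge0 ?rnorm_ge0//.
  by rewrite ler_wpM2r ?invr_ge0 ?rnorm_ge0// spectral_iter_contraction.
pose w := limn (series y); have yw : series y @ \oo --> w by [].
have Dy n : E closed_unit_disc (series y n) = series y n.
  rewrite /series /= lin_sum; apply: eq_bigr => k _.
  by rewrite /y linN linZ spectral_iter.
(* The projection is continuous, so the sum of the series stays in the subspace. *)
have Dw : E closed_unit_disc w = w.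
  have EM v : rnorm (E closed_unit_disc v) <= 1 * rnorm v.
    by rewrite mul1r (rnorm_pvm_le Hip Epvm).
  have := bounded_linear_cvg EM yw.
  have -> : (fun n => E closed_unit_disc (series y n)) = series y by apply/funext.
  by move=> lim; exact: (cvg_unique _ lim yw).
exists w; first exact/spectral_rangeP.
have lim1 : (fun n => A (series y n) - l *: series y n) @ \oo --> A w - l *: w.
  by apply: cvgB; [exact: bounded_linear_cvg AM yw|exact: cvgZr].
have lim2 : (fun n => A (series y n) - l *: series y n) @ \oo --> u.
  apply/cvg_rnormP => e e0.
  have : geometric (rnorm u) (rnorm l)^-1 n @[n --> \oo] --> 0 by exact: cvg_geometric.
  move=> /cvgrPdist_le /(_ e e0); apply: filterS => n.
  rewrite sub0r normrN /geometric /= => hn.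
  rewrite /series /= big_mkord neumann_partial// opprB addrC subrK.
  rewrite rnormZ rnormV rnormX (le_trans _ hn)// (le_trans _ (ler_norm _))//.
  by rewrite exprVn mulrC ler_wpM2r ?invr_ge0 ?exprn_ge0 ?rnorm_ge0// spectral_iter_contraction.
exact: (cvg_unique _ lim1 lim2).
Qed.

End SpectralSubspace.

(** * From the Bessel property to the Carleson condition *)

Section Equivalences.
Context {R : realType} {H : completeNormedModType R[i]}.
Variable ip : {dot H for conjC}.
Hypothesis Hip : norm_from_dot ip.
Variables (A : {linear H -> H}) (E : set (borelC R) -> {linear H -> H}).
Hypothesis Abounded : bounded_operator A.
Hypothesis AE : spectral_measure_of ip A E.
Variable x : H.
Hypothesis xE : range (E closed_unit_disc) x.
Implicit Types (u v : H) (D S : set (borelC R)).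

Let Epvm := spm_pvm AE.
Let mDisc := @measurable_closed_unit_disc R.

Let Dx : E closed_unit_disc x = x.
Proof. exact/(spectral_rangeP AE). Qed.

Lemma bessel_finite (y : nat -> H) (C : R) v n :
  (\sum_(0 <= k <oo) (rnorm (ip v (y k)) ^+ 2)%:E <= (C * rnorm v ^+ 2)%:E)%E ->
  \sum_(k < n) rnorm (ip v (y k)) ^+ 2 <= C * rnorm v ^+ 2.
Proof.
move=> h; rewrite -lee_fin -sumEFin; apply: le_trans h.
rewrite -(big_mkord xpredT (fun k => (rnorm (ip v (y k)) ^+ 2)%:E)).
by apply: nneseries_lim_ge => k _ _; rewrite lee_fin sqr_ge0.
Qed.

(** With [L] = |l|^2 this produces the factor (|l|^2 - 1)^-1 of the resolvent estimate; with [L] = 2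
    it sums the dyadic shells. *)
Lemma sum_geometric_inv (L : R) n : 1 < L ->
  \sum_(k < n) L^-1 ^+ k.+1 <= (L - 1)^-1.
Proof.
move=> L1; have L0 : L != 0 by rewrite gt_eqF// (lt_trans _ L1).
have -> : \sum_(k < n) L^-1 ^+ k.+1 = (1 - L^-1 ^+ n) / (L - 1).
  elim: n => [|n IH]; first by rewrite big_ord0 expr0 subrr mul0r.
  rewrite big_ord_recr /= IH exprS; field.
  by rewrite L0 subr_eq0 gt_eqF.
rewrite ler_piMl ?invr_ge0 ?subr_ge0 ?(ltW L1)// gerBl exprn_ge0// invr_ge0.
by rewrite (le_trans _ (ltW L1)).
Qed.

Lemma resolvent_expansion (l : R[i]) y n : l != 0 -> A y - l *: y = x ->
  y = l ^- n *: iter n A y - \sum_(k < n) l ^- k.+1 *: iter k A x.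
Proof.
move=> l0 yx; have iterB k u v : iter k A (u - v) = iter k A u - iter k A v.
  by elim: k => //= k ->; rewrite linB.
elim: n => [|n IH]; first by rewrite big_ord0 expr0 invr1 scale1r subr0.
rewrite {1}IH big_ord_recr /= opprD addrA [RHS]addrAC; congr (_ + _).
rewrite -yx iterB iter_linZ -iterS iterSr scalerBr opprB scalerA.
by rewrite exprS invfM mulrAC mulVf// mul1r addrC subrK.
Qed.

Lemma bessel_resolvent (C : R) (l : R[i]) y : 0 <= C -> 1 < rnorm l ->
  E closed_unit_disc y = y -> A y - l *: y = x ->
  (forall n, \sum_(k < n) rnorm (ip y (iter k A x)) ^+ 2 <= C * rnorm y ^+ 2) ->
  rnorm y ^+ 2 <= C * (rnorm l ^+ 2 - 1)^-1.
Proof.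
move=> C0 l1 Dy yx hC.
have l0 : l != 0 by rewrite -rnorm_eq0 gt_eqF// (lt_trans _ l1).
have L1 : 1 < rnorm l ^+ 2 by rewrite expr_gt1 ?rnorm_ge0.
have Lp : 0 < rnorm l by rewrite (lt_trans _ l1).
set B := C * _.
have B0 : 0 <= B by rewrite mulr_ge0 ?invr_ge0 ?subr_ge0 ?(ltW L1).
have [y0|y0] := eqVneq (rnorm y) 0; first by rewrite y0 expr0n.
have yp : 0 < rnorm y by rewrite lt_def y0 rnorm_ge0.
(* Cauchy-Schwarz between the geometric weights and the Bessel coefficients of [y]. *)
have S_le n : \sum_(k < n) (rnorm l)^-1 ^+ k.+1 * rnorm (ip y (iter k A x)) <=
    Num.sqrt B * rnorm y.
  rewrite -(@ler_pXn2r _ 2) ?nnegrE ?mulr_ge0 ?sqrtr_ge0 ?rnorm_ge0//; last first.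
    by apply: sumr_ge0 => k _; rewrite mulr_ge0 ?exprn_ge0 ?invr_ge0 ?rnorm_ge0.
  apply: (le_trans (cauchy_sum _ _)).
  rewrite exprMn sqr_sqrtr// /B [C * _]mulrC -mulrA.
  apply: ler_pM => //; try by apply: sumr_ge0 => k _; exact: sqr_ge0.
  under eq_bigr do rewrite -exprM mulnC exprM exprVn.
  exact: sum_geometric_inv.
(* Pairing [y] with its expansion leaves a remainder of at most |l|^-n |y|^2, since [iter n A] is a
   contraction on the subspace. *)
have main : rnorm y ^+ 2 <= Num.sqrt B * rnorm y.
  apply: (@ler_geometric_error _ _ _ (rnorm y ^+ 2) (rnorm l)^-1 0).
    by rewrite invr_ge0 ltW//= invf_lt1.
  move=> n _.
  have e := ip_rnorm Hip y.
  have -> : rnorm y ^+ 2 = rnorm (ip y y) by rewrite e rnorm_real ger0_norm ?sqr_ge0.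
  rewrite {2}(resolvent_expansion n l0 yx) ipDr ipNr ip_sumr (le_trans (rnormB _ _))//.
  rewrite addrC lerD//.
    apply: le_trans (S_le n); apply: le_trans (rnorm_sum _ _ _) _.
    by apply: ler_sum => k _; rewrite ipZr rnormM rnormJ rnormV rnormX exprVn.
  rewrite e rnorm_real ger0_norm ?sqr_ge0// ipZr rnormM rnormJ rnormV rnormX.
  rewrite mulrC exprVn ler_wpM2r ?invr_ge0 ?exprn_ge0 ?rnorm_ge0//.
  rewrite (le_trans (rnorm_ip_le Hip _ _))// expr2 ler_wpM2l ?rnorm_ge0//.
  exact: (spectral_iter_contraction Hip AE).
have ysB : rnorm y <= Num.sqrt B by rewrite -(ler_pM2r yp) -expr2.
rewrite -(sqr_sqrtr B0) ler_pXn2r ?nnegrE ?rnorm_ge0 ?sqrtr_ge0//.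
Qed.

Definition carleson_bound (C : R) := forall (r : R) (z : R[i]), 0 < r -> rnorm z = 1 ->
  spectral_meas ip E x (closed_unit_disc `&` ball (z : R[i]^o) (r%:C)) <= C * r.

(** For [r < eta] the resolvent at [(1 + r) z] gives (8 r)^2 M / ((1 + r)^2 - 1), at most 32 M r.
    For larger [r] the total mass |x|^2 is already at most |x|^2 r / eta. *)
Lemma carleson_of_resolvent (M eta : R) : 0 < M -> 0 < eta ->
  (forall l : R[i], 1 < rnorm l -> rnorm l < 1 + eta ->
     rnorm (restr_resolvent A (range (E closed_unit_disc)) l x) ^+ 2
       <= M * (rnorm l ^+ 2 - 1)^-1) ->
  carleson_bound (32 * M + rnorm x ^+ 2 / eta).
Proof.
move=> M0 eta0 h r z r0 z1; rewrite ballCE.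
have mD : measurable (closed_unit_disc `&` disc z r).
  by apply: measurableI; [exact: mDisc|exact: measurable_disc].
set D := _ `&` _; rewrite (spectral_measE Hip Epvm)// mulrDl.
have M1 : 0 <= 32 * M * r by rewrite !mulr_ge0 ?(ltW M0) ?(ltW r0).
have x0 : 0 <= rnorm x ^+ 2 / eta * r by rewrite !mulr_ge0 ?invr_ge0 ?rnorm_ge0 ?(ltW r0) ?(ltW eta0).
have [reta|etar] := ltP r eta; last first.
  apply: (@le_trans _ _ (rnorm x ^+ 2 / eta * r)); last by rewrite lerDr.
  apply: (@le_trans _ _ (rnorm x ^+ 2)).
    by rewrite ler_pXn2r ?nnegrE ?rnorm_ge0// (rnorm_pvm_le Hip Epvm).
  rewrite mulrAC ler_pdivlMr// ler_wpM2l//. exact: sqr_ge0.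
apply: (@le_trans _ _ (32 * M * r)); last by rewrite lerDl.
pose l : R[i] := (1 + r)%:C * z.
have lE : rnorm l = 1 + r by rewrite rnormM z1 mulr1 rnorm_real ger0_norm// addr_ge0// ltW.
have l1 : 1 < rnorm l by rewrite lE ltrDl.
have := h l l1; rewrite lE ltrD2l => /(_ reta).
have [] := restr_resolventP (spectral_resolvent_bij Hip AE Abounded l1) xE.
set y := restr_resolvent _ _ _ _ => /(spectral_rangeP AE) => /(_ mDisc) Dy yx hy.
have Dl (w : R[i]) : D w -> rnorm (w - l) <= 2 * r.
  move=> [_ zw]; have -> : w - l = (w - z) - r%:C * z by rewrite /l rmorphD /= mulrDl mul1r opprD addrA.
  rewrite (le_trans (rnormB _ _))// rnormM z1 mulr1 rnorm_real ger0_norm ?ltW//.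
  by move: zw; rewrite /disc /= rnorm_distC; lra.
have r20 : 0 < 2 * r by rewrite mulr_gt0.
have := spectral_local_bound Hip AE mD (pvm_idem Epvm y mD) r20 Dl.
rewrite -linZ (spectral_commute Hip AE)// -linB yx.
have := rnorm_pvm_le Hip Epvm y mD => Ey hE.
have {Ey}hE : rnorm (E D x) <= 8 * r * rnorm y.
  apply: (le_trans hE).
  have -> : 4 * (2 * r) = 8 * r by ring.
  by rewrite ler_wpM2l// mulr_ge0// ltW.
apply: (@le_trans _ _ ((8 * r * rnorm y) ^+ 2)).
  by rewrite ler_pXn2r ?nnegrE ?mulr_ge0 ?rnorm_ge0 ?(ltW r0).
rewrite exprMn; have p0 : 0 < (1 + r) ^+ 2 - 1 by nra.
have : (8 * r) ^+ 2 * rnorm y ^+ 2 <= (8 * r) ^+ 2 * (M * ((1 + r) ^+ 2 - 1)^-1).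
  by rewrite ler_wpM2l// sqr_ge0.
move/le_trans; apply; rewrite mulrA ler_pdivrMr//.
have -> : 32 * M * r * ((1 + r) ^+ 2 - 1) = (8 * r) ^+ 2 * M + 32 * M * r ^+ 3 by ring.
by rewrite lerDl !mulr_ge0 ?exprn_ge0 ?(ltW M0) ?(ltW r0).
Qed.

End Equivalences.

(** * From the Carleson condition to the Bessel property *)

Section DyadicShells.
Context {R : realType}.

Lemma unit_direction (w : R[i]) :
  exists2 z : R[i], rnorm z = 1 & w = (rnorm w)%:C * z.
Proof.
have [->|w0] := eqVneq w 0; first by exists 1; rewrite ?rnorm1// rnorm0 mul0r.
have r0 : rnorm w != 0 by rewrite rnorm_eq0.
exists ((rnorm w)^-1%:C * w).
  by rewrite rnormM rnorm_real ger0_norm ?invr_ge0 ?rnorm_ge0// mulVf.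
by rewrite mulrA -rmorphM mulfV// mul1r.
Qed.

(** Rotating by [z], the distance from [w] to [y] is |z - |w| y|, and z - y differs from z - |w| y
    by (1 - |w|) y, which is no longer than that distance. *)
Lemma disc_dist_radial (w z y : R[i]) : rnorm w <= 1 -> rnorm y <= 1 ->
  rnorm z = 1 -> w = (rnorm w)%:C * z -> rnorm (z - y) <= 2 * disc_dist w y.
Proof.
move=> w1 y1 z1 wz.
have e : disc_dist w y = rnorm (z - (rnorm w)%:C * y).
  rewrite -[RHS]mul1r -{1}z1 -(rnormJ z) -rnormM mulrBr.
  have -> : conjc z * z = 1 by rewrite mulrC -sqr_normc rnormE z1 expr1n.
  by rewrite /disc_dist {1}wz conjc_realM mulrCA mulrA.
have -> : z - y = (z - (rnorm w)%:C * y) - (1 - rnorm w)%:C * y.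
  by rewrite rmorphB /=; ring.
rewrite (le_trans (rnormB _ _))// -e rnormM rnorm_real ger0_norm ?subr_ge0//.
have := disc_dist_ge w y1; have := rnorm_ge0 w; have := rnorm_ge0 y.
have := rnorm_ge0 (1 - conjc w * y); rewrite -/(disc_dist w y); nra.
Qed.

(** The first level [k] with t < 2^k h suffices: there 2^k h <= 4 d, either because [k] is 0 and h
    <= d, or because 2^(k-1) h <= t <= 2 d. The other terms are nonnegative. *)
Lemma dyadic_shells (d t h : R) (n : nat) : 0 < h -> h <= d -> t <= 2 * d ->
  t < 2 ^+ n * h ->
  (d ^+ 2)^-1 <= \sum_(k < n.+1) (if t < 2 ^+ k * h then 16 / (4 ^+ k * h ^+ 2) else 0).
Proof.
move=> h0 hd td; have d0 : 0 < d := lt_le_trans h0 hd.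
have p4 : 0 < 4 :> R by [].
have dn k (c : R) : 0 < c -> 2 ^+ k * h <= c * d -> (d ^+ 2)^-1 <= c ^+ 2 / (4 ^+ k * h ^+ 2).
  move=> c0 hk; have p0 : 0 < 4 ^+ k * h ^+ 2 by rewrite mulr_gt0 ?exprn_gt0.
  rewrite ler_pdivlMr// mulrC ler_pdivrMr ?exprn_gt0//.
  have -> : 4 ^+ k * h ^+ 2 = (2 ^+ k * h) ^+ 2.
    by rewrite exprMn -exprM mulnC exprM; congr (_ ^+ _ * _); rewrite -natrX.
  by rewrite -exprMn ler_pXn2r ?nnegrE ?mulr_ge0 ?exprn_ge0 ?(ltW h0) ?(ltW c0) ?(ltW d0).
elim: n => [|n IH] tn.
  rewrite big_ord_recl big_ord0 tn addr0.
  have := dn 0%N 4; rewrite !expr0 !mul1r => /(_ p4).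
  have -> : 4 ^+ 2 = 16 :> R by rewrite -natrX.
  by apply; lra.
rewrite big_ord_recr /= tn.
have [/IH h1|t_ge] := ltP t (2 ^+ n * h).
  by rewrite (le_trans h1)// lerDl divr_ge0// mulr_ge0 ?exprn_ge0 ?(ltW h0).
rewrite (le_trans (dn n.+1 4 p4 _))//.
  by rewrite exprS; lra.
have -> : 4 ^+ 2 = 16 :> R by rewrite -natrX.
rewrite lerDr; apply: sumr_ge0 => k _; case: ifP => // _.
by rewrite divr_ge0// mulr_ge0 ?exprn_ge0 ?(ltW h0).
Qed.

(* The growth hypothesis is only used at the radial projection [z] of [w i] on
   the circle, [disc_dist (w i) y] being comparable to [h + |z - y|]. *)
Lemma kernel_test_of_growth {I : finType} (m : I -> R) (w : I -> R[i]) (C : R) (i : I) :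
  (forall j, 0 <= m j) -> (forall j, rnorm (w j) < 1) -> 0 <= C ->
  (forall (z : R[i]) (s : R), rnorm z = 1 -> 1 - rnorm (w i) <= s ->
     \sum_(j | rnorm (z - w j) < s) m j <= C * s) ->
  \sum_j m j * ((1 - rnorm (w i) ^+ 2) / disc_dist (w i) (w j) ^+ 2) <= 64 * C.
Proof.
move=> m0 w1 C0 growth.
have [z z1 wz] := unit_direction (w i).
pose h := 1 - rnorm (w i); have h0 : 0 < h by rewrite subr_gt0.
(* The last shell must contain every atom, and [z] is at distance less than 2 from each. *)
have [n hn] : exists n, 2 < 2 ^+ n * h.
  exists (Num.truncn (2 / h)).+1; rewrite -ltr_pdivrMr//.
  rewrite (lt_le_trans (truncnS_gt _))// -natrX ler_nat ltnW// ltn_expl//.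
have shell j : (disc_dist (w i) (w j) ^+ 2)^-1 <= \sum_(k < n.+1)
    (if rnorm (z - w j) < 2 ^+ k * h then 16 / (4 ^+ k * h ^+ 2) else 0).
  apply: dyadic_shells => //; first exact/disc_dist_ge/ltW.
    by apply: disc_dist_radial => //; exact: ltW.
  by rewrite (le_lt_trans _ hn)// (le_trans (rnormB _ _))// z1; have := w1 j; lra.
apply: (@le_trans _ _ (2 * h * \sum_(k < n.+1) 16 / (4 ^+ k * h ^+ 2) *
    \sum_(j | rnorm (z - w j) < 2 ^+ k * h) m j)).
  apply: (@le_trans _ _ (2 * h * \sum_j m j * (disc_dist (w i) (w j) ^+ 2)^-1)).
    rewrite big_distrr; apply: ler_sum => j _ /=.
    rewrite [leRHS]mulrCA ler_wpM2l// ler_wpM2r ?invr_ge0 ?sqr_ge0//.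
    by rewrite /h; have := rnorm_ge0 (w i); have := w1 i; nra.
  rewrite ler_wpM2l ?mulr_ge0 ?(ltW h0)//.
  apply: (@le_trans _ _ (\sum_j \sum_(k < n.+1)
     m j * (if rnorm (z - w j) < 2 ^+ k * h then 16 / (4 ^+ k * h ^+ 2) else 0))).
    by apply: ler_sum => j _; rewrite -big_distrr ler_wpM2l.
  rewrite exchange_big /=; apply: ler_sum => k _.
  rewrite big_distrr /= [leRHS]big_mkcond /=; apply: ler_sum => j _.
  by case: ifP => _; rewrite ?mulr0// mulrC.
have hk (k : nat) : h <= 2 ^+ k * h by rewrite ler_peMl ?(ltW h0)// exprn_ege1// ler1n.
(* Growth at radius 2^k h bounds shell [k] by 16 C / (2^k h); the shells then sum to at most 32 C /
   h. *)
apply: (@le_trans _ _ (2 * h * \sum_(k < n.+1) 32 * C / h * 2^-1 ^+ k.+1)).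
  rewrite ler_wpM2l ?mulr_ge0 ?(ltW h0)//; apply: ler_sum => k _.
  have c0 : 0 <= 16 / (4 ^+ k * h ^+ 2).
    by rewrite divr_ge0// mulr_ge0 ?exprn_ge0 ?(ltW h0).
  rewrite (le_trans (ler_wpM2l c0 (growth z _ z1 (hk k))))//.
  have -> : 4 ^+ k = 2 ^+ k * 2 ^+ k :> R by rewrite -exprMn -natrM.
  rewrite le_eqVlt; apply/orP; left; apply/eqP; rewrite (exprS 2^-1) exprVn; field.
  by rewrite expf_neq0 ?gt_eqF.
rewrite -big_distrr /= (@le_trans _ _ (2 * h * (32 * C / h * 1)))//.
  rewrite ler_wpM2l ?mulr_ge0 ?(ltW h0)// ler_wpM2l//.
    by rewrite divr_ge0 ?mulr_ge0 ?(ltW h0).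
  have := @sum_geometric_inv R 2 n.+1; rewrite (_ : 2 - 1 = 1) ?invr1; last by ring.
  by apply; rewrite ltr1n.
by rewrite le_eqVlt; apply/orP; left; apply/eqP; field; rewrite gt_eqF.
Qed.

End DyadicShells.

Section BesselOfCarleson.
Context {R : realType} {H : completeNormedModType R[i]}.
Variable ip : {dot H for conjC}.
Hypothesis Hip : norm_from_dot ip.
Variables (A : {linear H -> H}) (E : set (borelC R) -> {linear H -> H}).
Hypothesis AE : spectral_measure_of ip A E.
Variable x : H.
Hypothesis xE : range (E closed_unit_disc) x.
Implicit Types (u v : H) (D S : set (borelC R)).

Let Epvm := spm_pvm AE.
Let mDisc := @measurable_closed_unit_disc R.

Let Dx : E closed_unit_disc x = x.
Proof. exact/(spectral_rangeP AE). Qed.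

(** Induction on A^(k+1) - w^(k+1) = A^k (A - w) + w (A^k - w^k), where neither A^k nor [w]
    increases norms. *)
Lemma iter_power_diff u (w : R[i]) k : E closed_unit_disc u = u -> rnorm w <= 1 ->
  rnorm (iter k A u - w ^+ k *: u) <= k%:R * rnorm (A u - w *: u).
Proof.
move=> Du w1; elim: k => [|k IH]; first by rewrite scale1r subrr rnorm0 mul0r.
have iterB i a b : iter i A (a - b) = iter i A a - iter i A b.
  by elim: i => //= i ->; rewrite linB.
have -> : iter k.+1 A u - w ^+ k.+1 *: u =
    iter k A (A u - w *: u) + w *: (iter k A u - w ^+ k *: u).
  by rewrite iterB iter_linZ -iterSr scalerBr scalerA -exprS addrA subrK.
rewrite (le_trans (rnormD _ _))// -natr1 mulrDl mul1r addrC lerD//.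
  by rewrite rnormZ (le_trans _ IH)// ler_piMl ?rnorm_ge0.
apply: (spectral_iter_contraction Hip AE).
by rewrite linB linZ -(spectral_commute Hip AE)// Du.
Qed.

(** * Discretization of [x] into contracted atoms *)

Section Atoms.
Variables (C e : R).
Hypothesis C0 : 0 <= C.
Hypothesis growth : carleson_bound ip E x C.
Hypothesis e0 : 0 < e.
Hypothesis e1 : e <= 1.
Variables (N : nat) (F : nat -> set (borelC R)) (z : nat -> R[i]).
Hypothesis mF : forall n, measurable (F n).
Hypothesis tF : trivIset setT F.
Hypothesis F0 : forall n, (N <= n)%N -> F n = set0.
Hypothesis UF : \bigcup_n F n = closed_unit_disc.
Hypothesis z1 : forall n, rnorm (z n) <= 1.
Hypothesis zF : forall n (w : R[i]), F n w -> rnorm (w - z n) <= e.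

(* Contracting the atoms keeps them at distance at least [e] from the circle, so
   that the Carleson condition is only tested at scales above the mesh. *)
Let w (n : 'I_N) : R[i] := (1 - e)%:C * z n.

Let F_disc n p : F n p -> closed_unit_disc p.
Proof. by move=> Fp; rewrite -UF; exists n. Qed.

Let w_le n : rnorm (w n) <= 1 - e.
Proof.
by rewrite rnormM rnorm_real ger0_norm ?subr_ge0// ler_piMr// subr_ge0.
Qed.

Let zw (n : 'I_N) : rnorm (z n - w n) <= e.
Proof.
have -> : z n - w n = e%:C * z n by rewrite /w rmorphB /=; ring.
by rewrite rnormM rnorm_real ger0_norm ?(ltW e0)// ler_piMr// ltW.
Qed.

(** A cell lies within [e] of [z j], itself within [e] of [w j], so the cells counted lie in the
    disc of radius s + 2 e <= 3 s, whence the factor 3. *)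
Lemma atoms_growth (c : R[i]) (s : R) : rnorm c = 1 -> e <= s ->
  \sum_(j < N | rnorm (c - w j) < s) rnorm (E (F j) x) ^+ 2 <= 3 * C * s.
Proof.
move=> c1 es; pose D := closed_unit_disc `&` disc c (s + 2 * e).
have mD : measurable D by apply: measurableI => //; exact: measurable_disc.
have s0 : 0 < s + 2 * e by move: e0 es; lra.
have := growth s0 c1; rewrite ballCE -/D (spectral_measE Hip Epvm)// => hD.
apply: (@le_trans _ _ (rnorm (E D x) ^+ 2)); last first.
  apply: (le_trans hD); have : C * (s + 2 * e) <= C * (3 * s) by apply: ler_wpM2l => //; lra.
  by lra.
apply: le_trans (pvm_bessel Hip Epvm N (E D x) mF tF).
rewrite big_mkcond; apply: ler_sum => j _; case: ifPn => [cw|_]; last exact: sqr_ge0.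
rewrite (pvm_sub Epvm)// => p Fp; split; first exact: (F_disc Fp).
rewrite /disc /=.
have -> : c - p = (c - w j) + ((z j - p) - (z j - w j)) by ring.
rewrite (le_lt_trans (rnormD _ _))//.
have := rnormB (z j - p) (z j - w j).
by have := zw j; have := zF Fp; rewrite (rnorm_distC p); lra.
Qed.

Lemma atoms_bessel v n :
  \sum_(k < n) rnorm (ip (\sum_(j < N) w j ^+ k *: E (F j) x) v) ^+ 2 <=
    (2 * rnorm x ^+ 2 + 80 * (64 * (3 * C))) * rnorm v ^+ 2.
Proof.
pose m (j : 'I_N) := rnorm (E (F j) x) ^+ 2.
pose t (j : 'I_N) := rnorm (E (F j) v) ^+ 2.
pose g (j : 'I_N) := ip (E (F j) x) v.
have m0 j : 0 <= m j := sqr_ge0 _.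
have t0 j : 0 <= t j := sqr_ge0 _.
have rho1 : 1 - e < 1 by rewrite gtrBl.
have w1 j : rnorm (w j) < 1 := le_lt_trans (w_le j) rho1.
(* A projection may be moved onto [v], so each coefficient sees only the parts of [x] and [v] in its
   cell. *)
have gm j : rnorm (g j) ^+ 2 <= m j * t j.
  rewrite /g -(pvm_idem Epvm x (mF j)) (pvm_adj Epvm _ _ (mF j)) -exprMn.
  by rewrite ler_pXn2r ?nnegrE ?mulr_ge0 ?rnorm_ge0// rnorm_ip_le.
have test i : \sum_j m j * ((1 - rnorm (w i) ^+ 2) / disc_dist (w i) (w j) ^+ 2)
    <= 64 * (3 * C).
  apply: kernel_test_of_growth => //; first by rewrite mulr_ge0.
  move=> c s c1 hs; apply: atoms_growth => //.
  by apply: le_trans hs; have := w_le i; lra.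
have := finite_carleson w_le rho1 m0 t0 test n gm.
under eq_bigr => k _.
  have -> : \sum_i g i * w i ^+ k = ip (\sum_(j < N) w j ^+ k *: E (F j) x) v.
    by rewrite ip_suml; apply: eq_bigr => j _; rewrite ipZl mulrC.
  over.
move/le_trans; apply.
have mx : \sum_i m i <= rnorm x ^+ 2 := pvm_bessel Hip Epvm N x mF tF.
have tv : \sum_i t i <= rnorm v ^+ 2 := pvm_bessel Hip Epvm N v mF tF.
apply: ler_pM => //.
- by rewrite addr_ge0 ?mulr_ge0// sumr_ge0.
- by rewrite sumr_ge0.
by rewrite lerD2r ler_wpM2l.
Qed.

(** On each cell [A] is within 4 [e] of [z j], which is within [e] of [w j]: hence 5. The factor [k]
    comes from [iter_power_diff], and orthogonality adds the cells in squares. *)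
Lemma atoms_approx k :
  rnorm (iter k A x - \sum_(j < N) w j ^+ k *: E (F j) x) <= 5 * k%:R * e * rnorm x.
Proof.
have xsum := spectral_decomposition AE mF tF F0 UF Dx.
have iter_sum i (G : 'I_N -> H) : iter i A (\sum_j G j) = \sum_j iter i A (G j).
  by elim: i => //= i ->; rewrite lin_sum.
pose G (j : 'I_N) := iter k A (E (F j) x) - w j ^+ k *: E (F j) x.
have EG (j : 'I_N) : E (F j) (G j) = G j.
  by rewrite /G linB linZ (spectral_iter Hip AE)// (pvm_idem Epvm).
have -> : iter k A x - \sum_(j < N) w j ^+ k *: E (F j) x = \sum_(j < N) E (F j) (G j).
  rewrite {1}xsum iter_sum -sumrB; apply: eq_bigr => j _; by rewrite EG.
have b0 : 0 <= 5 * k%:R * e * rnorm x by rewrite !mulr_ge0 ?rnorm_ge0 ?(ltW e0).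
rewrite -(@ler_pXn2r _ 2) ?nnegrE ?rnorm_ge0// (pvm_sum_orthogonal Hip Epvm)//.
rewrite [leRHS]exprMn; apply: (@le_trans _ _ ((5 * k%:R * e) ^+ 2 *
    \sum_(j < N) rnorm (E (F j) x) ^+ 2)); last first.
  by rewrite ler_wpM2l ?sqr_ge0// (pvm_bessel Hip Epvm N x mF tF).
rewrite big_distrr; apply: ler_sum => j _ /=; rewrite EG -exprMn.
rewrite ler_pXn2r ?nnegrE ?mulr_ge0 ?rnorm_ge0 ?(ltW e0)//.
have mFj := mF j; have Fj := pvm_idem Epvm x mFj.
have DFj : E closed_unit_disc (E (F j) x) = E (F j) x.
  by apply: (pvm_sup Epvm) => // p; exact: F_disc.
have wj1 : rnorm (w j) <= 1 by rewrite (le_trans (w_le j))// gerBl ltW.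
apply: (le_trans (iter_power_diff k DFj wj1)).
rewrite -!mulrA mulrCA ler_wpM2l// mulrA.
have h := spectral_local_bound Hip AE mFj Fj e0 (@zF j).
have -> : A (E (F j) x) - w j *: E (F j) x =
    (A (E (F j) x) - z j *: E (F j) x) + (z j - w j) *: E (F j) x.
  by rewrite scalerBl addrA subrK.
apply: (le_trans (rnormD _ _)); rewrite rnormZ.
have := ler_wpM2r (rnorm_ge0 (E (F j) x)) (zw j); lra.
Qed.

End Atoms.

Lemma bessel_of_carleson (C : R) : 0 <= C -> carleson_bound ip E x C ->
  bessel ip (fun k => iter k A x).
Proof.
move=> C0 growth.
pose B := 2 * rnorm x ^+ 2 + 80 * (64 * (3 * C)).
have B0 : 0 <= B by rewrite addr_ge0 ?mulr_ge0 ?rnorm_ge0.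
have fin v n : \sum_(k < n) rnorm (ip v (iter k A x)) ^+ 2 <= (2 * B + 1) * rnorm v ^+ 2.
  (* The mesh may depend on [n] since the atomic bound [B] does not. The [n] errors total q e^2
     |v|^2, with 50 = 2 times 5^2, and [e = (2 + q)^-1] makes this at most |v|^2, the extra 1 in the
     constant. *)
  pose q : R := 50 * n%:R ^+ 3 * rnorm x ^+ 2.
  have q0 : 0 <= q by rewrite !mulr_ge0 ?exprn_ge0 ?rnorm_ge0.
  pose e := (2 + q)^-1.
  have p0 : 0 < 2 + q by lra.
  have e0 : 0 < e by rewrite invr_gt0.
  have e1 : e <= 1 by rewrite invf_le1//; lra.
  have qe : q * e <= 1 by rewrite ler_pdivrMr//; lra.
  have [N [F [z [mF tF F0 UF zF]]]] := closed_unit_disc_partition e0.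
  have z1 j : rnorm (z j) <= 1 by case: (zF j).
  have zF' j (p : R[i]) : F j p -> rnorm (p - z j) <= e by case: (zF j) => _; apply.
  pose w (j : 'I_N) := (1 - e)%:C * z j.
  pose s k := \sum_(j < N) w j ^+ k *: E (F j) x.
  have hb : \sum_(k < n) rnorm (ip (s k) v) ^+ 2 <= B * rnorm v ^+ 2.
    exact: atoms_bessel.
  have ha k : rnorm (iter k A x - s k) <= 5 * k%:R * e * rnorm x.
    exact: (atoms_approx e0 e1 mF tF F0 UF z1 zF').
  have each (k : 'I_n) : rnorm (ip v (iter k A x)) ^+ 2 <=
      2 * rnorm (ip (s k) v) ^+ 2 + 2 * (5 * n%:R * e * rnorm x * rnorm v) ^+ 2.
    have -> : rnorm (ip v (iter k A x)) = rnorm (ip (iter k A x) v).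
      by rewrite ipC rnormJ.
    rewrite -[iter k A x](subrK (s k)) ipDl.
    have d : rnorm (ip (iter k A x - s k) v) <= 5 * n%:R * e * rnorm x * rnorm v.
      apply: (le_trans (rnorm_ip_le Hip _ _)); rewrite ler_wpM2r ?rnorm_ge0//.
      apply: (le_trans (ha k)); rewrite !ler_wpM2r ?rnorm_ge0 ?(ltW e0)//.
      by rewrite ler_wpM2l// ler_nat ltnW.
    set b := rnorm (ip (iter k A x - s k) v) in d *; set c := rnorm (ip (s k) v).
    have b0 : 0 <= b := rnorm_ge0 _; have c0 : 0 <= c := rnorm_ge0 _.
    have bd : b ^+ 2 <= (5 * n%:R * e * rnorm x * rnorm v) ^+ 2.
      by rewrite ler_pXn2r ?nnegrE// (le_trans b0).
    have ac : rnorm (ip (iter k A x - s k) v + ip (s k) v) ^+ 2 <= (b + c) ^+ 2.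
      by rewrite ler_pXn2r ?nnegrE ?rnorm_ge0 ?addr_ge0// rnormD.
    have := sqr_ge0 (b - c); lra.
  apply: (le_trans (ler_sum _ (fun k _ => each k))).
  rewrite big_split /= -big_distrr /= sumr_const card_ord -[_ *+ n]mulr_natr.
  have -> : 2 * (5 * n%:R * e * rnorm x * rnorm v) ^+ 2 * n%:R = q * e * e * rnorm v ^+ 2.
    by rewrite /q; ring.
  have qee : q * e * e * rnorm v ^+ 2 <= 1 * rnorm v ^+ 2.
    apply: ler_wpM2r; first exact: sqr_ge0.
    apply: mulr_ile1 => //; last exact: ltW.
    by apply: mulr_ge0 => //; exact: ltW.
  have -> : (2 * B + 1) * rnorm v ^+ 2 = 2 * (B * rnorm v ^+ 2) + 1 * rnorm v ^+ 2 by ring.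
  by rewrite lerD// ler_wpM2l.
exists (2 * B + 1); split; first by lra.
move=> v; apply: lime_le.
  by apply: is_cvg_nneseries => k _ _; rewrite lee_fin sqr_ge0.
apply: nearW => n; rewrite sumEFin lee_fin big_mkord.
exact: fin.
Qed.

End BesselOfCarleson.

Theorem theorem4p5 (R : realType) (H : completeNormedModType R[i])
    (ip : {dot H for conjC}) (Hip : norm_from_dot ip)
    (A : {linear H -> H}) (hbounded : bounded_operator A)
    (hnormal : normal_operator ip A)
    (E : set (borelC R) -> {linear H -> H}) (hE : spectral_measure_of ip A E)
    (x : H) (hx : range (E closed_unit_disc) x) :
  let i := bessel ip (fun k => iter k A x) in
  let ii := exists C1 : R, 0 < C1 /\
    forall (r : R) (z : R[i]), 0 < r -> rnorm z = 1 ->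
      spectral_meas ip E x
        (closed_unit_disc `&` ball (z : R[i]^o) (r%:C)) <= C1 * r in
  let iii := exists M eta : R, 0 < M /\ 0 < eta /\
    forall l : R[i], 1 < rnorm l -> rnorm l < 1 + eta ->
      rnorm (restr_resolvent A (range (E closed_unit_disc)) l x) ^+ 2
        <= M * (rnorm l ^+ 2 - 1)^-1 in
  (i <-> ii) /\ (ii <-> iii).
Proof.
move=> i ii iii.
have i_iii : i -> iii.
  (* The estimate holds for all |l| > 1, so the width 1 is arbitrary. *)
  move=> [C [C0 hC]]; exists C, 1; split=> //; split=> // l l1 _.
  have [] := restr_resolventP (spectral_resolvent_bij Hip hE hbounded l1) hx.
  set y := restr_resolvent _ _ _ _.
  move=> /(spectral_rangeP hE) => /(_ (@measurable_closed_unit_disc R)) Dy yx.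
  apply: (bessel_resolvent Hip hE (ltW C0) l1 Dy yx) => n.
  exact: bessel_finite (hC y).
have iii_ii : iii -> ii.
  move=> [M [eta [M0 [eta0 h]]]].
  exists (32 * M + rnorm x ^+ 2 / eta); split.
    by rewrite ltr_pwDl ?mulr_gt0// divr_ge0 ?sqr_ge0// ltW.
  exact: (carleson_of_resolvent Hip hbounded hE hx M0 eta0 h).
have ii_i : ii -> i.
  by move=> [C [C0 hC]]; exact: (bessel_of_carleson Hip hE hx (ltW C0) hC).
by split; split => //; [move/i_iii/iii_ii|move/ii_i/i_iii].
Qed.
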